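(* Let $n\in\mathbb{N}$, and let $X\sim E_n(\mu,\Sigma,\psi)$ be an $n$-dimensional elliptical random vector with finite covariance matrix, $\mathrm{Var}[X]<\infty$, satisfying the standing assumptions in the context. Let $a\in\mathbb{R}^n\setminus\{0\}$ (a row vector) and $Y=aX=\sum_{i=1}^n a_iX_i$. Let $B=\{Y\in B_1\}$, where $B_1\subseteq\mathbb{R}$ is a Borel set with $\mathbb{P}[Y\in B_1]>0$. Then $$\mathrm{Var}_{B}[X] = k(B)\,\mathrm{Var}[X]+\left(\mathrm{Var}_{B}[Y]-k(B)\,\mathrm{Var}[Y]\right)\beta\beta^{T},$$ where $k(B)=K(\psi,F_Y(B_1))$ is the $K$-invariant, $F_Y$ is the distribution function of $Y$, $F_Y(B_1)$ is the image of $B_1$ under $F_Y$, and $\beta=\frac{\mathrm{Cov}[X,Y]}{\mathrm{Var}[Y]}=\frac{1}{a\Sigma a^T}\Sigma a^T$ (a column vector).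
   Context: Elliptical vectors: $X\sim E_n(\mu,\Sigma,\psi)$ means that $X=(X_1,\dots,X_n)^T$ is a random vector on a probability space $(\Omega,\mathcal{M},\mathbb{P})$ with $\mathbb{E}[\exp(-ix^T(X-\mu))]=\psi(x^T\Sigma x)$ for all $x\in\mathbb{R}^n$; $\psi$ is called the characteristic generator. Standing assumptions: $X$ has a continuous distribution function and admits the representation $X\stackrel{d}{=}\mu+RAU$, where $R$ is a (strictly) positive random variable with $\mathbb{E}[R^2]=n$, $A$ is an invertible $n\times n$ matrix with $AA^T=\Sigma$ ($\Sigma$ positive definite), and $U$ is independent of $R$ and uniformly distributed on the unit sphere of $\mathbb{R}^n$. Under this normalization $\mathrm{Var}[X]=\Sigma$. Conditional moments: for an event $B$ with $\mathbb{P}[B]>0$ and a random vector $Z$, $\mathbb{E}_B[Z]=\mathbb{E}[Z\mid B]$ and $\mathrm{Var}_B[Z]=\mathbb{E}[(Z-\mathbb{E}_B[Z])(Z-\mathbb{E}_B[Z])^T\mid B]$. $K$-invariant: for a characteristic generator $\psi$ and a Borel set $A\subseteq(0,1)$ of positive Lebesgue measure, $$K(\psi,A)=\mathrm{Var}[V_2\mid F_1(V_1)\in A],$$ where $V=(V_1,V_2)\sim E_2(0,\mathrm{Id}_2,\psi)$ and $F_1$ is the distribution function of $V_1$. It is understood that $\psi$ is such that the bivariate distribution $E_2(0,\mathrm{Id}_2,\psi)$ exists (automatic when $n\ge 2$, since margins of elliptical vectors are elliptical with the same generator). If $F_Y(B_1)$ contains $0$ or $1$, these points are discarded (this does not change the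 conditioning event up to null sets). *)

(* Defs.v *)
From HB Require Import structures.
From mathcomp Require Import all_boot all_order all_algebra.
From mathcomp Require Import all_classical all_reals all_analysis.
From mathcomp Require Import complex.

Set Implicit Arguments.
Unset Strict Implicit.
Unset Printing Implicit Defensive.

Import Order.TTheory GRing.Theory Num.Theory.
Import numFieldNormedType.Exports.

Local Open Scope classical_set_scope.
Local Open Scope ring_scope.

(** Random vectors *)

(* R^n with its Borel sigma-algebra; convertible to 'cV[R]_n. *)
Notation borel_cV R n := (g_sigma_algebraType (@open 'cV[R]_n)).

Definition random_vector d (T : measurableType d) (R : realType) (n : nat)
    (X : T -> 'cV[R]_n) : Prop :=
  measurable_fun [set: T] (X : T -> borel_cV R n).

Definition eq_law d (T : measurableType d) d' (T' : measurableType d')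
    (R : realType) (n : nat) (P : probability T R) (X : T -> 'cV[R]_n)
    (P' : probability T' R) (X' : T' -> 'cV[R]_n) : Prop :=
  forall D : set (borel_cV R n), measurable D ->
    P (X @^-1` D) = P' (X' @^-1` D).

Definition indep d (T : measurableType d) (R : realType) (n : nat)
    (P : probability T R) (Z : T -> R) (U : T -> 'cV[R]_n) : Prop :=
  forall (B : set R) (D : set (borel_cV R n)), measurable B -> measurable D ->
    P (Z @^-1` B `&` U @^-1` D) = (P (Z @^-1` B) * P (U @^-1` D))%E.

Definition df d (T : measurableType d) (R : realType) (P : probability T R)
    (Y : T -> R) (r : R) : R :=
  fine (P (Y @^-1` `]-oo, r])).

Definition joint_df d (T : measurableType d) (R : realType) (n : nat)
    (P : probability T R) (X : T -> 'cV[R]_n) (x : 'cV[R]_n) : R :=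
  fine (P [set w | forall i, X w i 0 <= x i 0]).

Definition cov_mx d (T : measurableType d) (R : realType) (n : nat)
    (P : probability T R) (X : T -> 'cV[R]_n) : 'M[R]_n :=
  \matrix_(i, j) fine (covariance P (fun w => X w i 0) (fun w => X w j 0)).

Definition cov_vec d (T : measurableType d) (R : realType) (n : nat)
    (P : probability T R) (X : T -> 'cV[R]_n) (Y : T -> R) : 'cV[R]_n :=
  \col_i fine (covariance P (fun w => X w i 0) Y).

(** Conditional moments given an event of positive probability *)

Definition cond_exp d (T : measurableType d) (R : realType)
    (P : probability T R) (B : set T) (Z : T -> R) : R :=
  (\int[P]_(w in B) Z w) / fine (P B).

Definition cond_cov d (T : measurableType d) (R : realType)
    (P : probability T R) (B : set T) (Z W : T -> R) : R :=
  cond_exp P B (fun w => (Z w - cond_exp P B Z) * (W w - cond_exp P B W)).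

Definition cond_var d (T : measurableType d) (R : realType)
    (P : probability T R) (B : set T) (Z : T -> R) : R :=
  cond_cov P B Z Z.

Definition cond_cov_mx d (T : measurableType d) (R : realType) (n : nat)
    (P : probability T R) (B : set T) (X : T -> 'cV[R]_n) : 'M[R]_n :=
  \matrix_(i, j) cond_cov P B (fun w => X w i 0) (fun w => X w j 0).

(** Elliptical vectors *)

Definition cexpectation d (T : measurableType d) (R : realType)
    (P : probability T R) (Z : T -> R[i]) : R[i] :=
  (fine 'E_P[fun w => complex.Re (Z w)]%E +i*
   fine 'E_P[fun w => complex.Im (Z w)]%E)%C.

(* exp(- i t) *)
Definition expNi (R : realType) (t : R) : R[i] := (cos t +i* - sin t)%C.

(* Only the values of psi on the nonnegative half-line matter. *)
Definition elliptical d (T : measurableType d) (R : realType) (n : nat)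
    (P : probability T R) (X : T -> 'cV[R]_n)
    (mu : 'cV[R]_n) (Sigma : 'M[R]_n) (psi : R -> R[i]) : Prop :=
  random_vector X /\
  forall x : 'cV[R]_n,
    cexpectation P (fun w => expNi ((x^T *m (X w - mu)) 0 0)) =
    psi ((x^T *m Sigma *m x) 0 0).

Definition posdef_mx (R : realType) (n : nat) (S : 'M[R]_n) : Prop :=
  S^T = S /\ forall x : 'cV[R]_n, x != 0 -> 0 < (x^T *m S *m x) 0 0.

(* The uniform distribution on the unit sphere of R^n is the
   orthogonally invariant probability distribution carried by that sphere. *)
Definition uniform_sphere d (T : measurableType d) (R : realType) (n : nat)
    (P : probability T R) (U : T -> 'cV[R]_n) : Prop :=
  [/\ random_vector U,
      P [set w | \sum_i U w i 0 ^+ 2 = 1] = 1%E &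
      forall O : 'M[R]_n, O *m O^T = 1%:M ->
        eq_law P (fun w => O *m U w) P U].

Definition stochastic_repr d (T : measurableType d) (R : realType) (n : nat)
    (P : probability T R) (X : T -> 'cV[R]_n)
    (mu : 'cV[R]_n) (Sigma : 'M[R]_n) : Prop :=
  exists (d' : measure_display) (T' : measurableType d')
    (P' : probability T' R) (rho : T' -> R) (A : 'M[R]_n)
    (U : T' -> 'cV[R]_n),
    [/\ [/\ measurable_fun [set: T'] rho,
            P' [set w | 0 < rho w] = 1%E &
            ('E_P'[fun w => (rho w ^+ 2)%R] = (n%:R)%:E)%E],
        A \in unitmx /\ A *m A^T = Sigma,
        uniform_sphere P' U,
        indep P' rho U &
        eq_law P X P' (fun w => mu + rho w *: (A *m U w))].

(** The K-invariant *)

Definition bivariate_exists (R : realType) (psi : R -> R[i]) : Prop :=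
  exists (d : measure_display) (T : measurableType d)
    (P : probability T R) (V : T -> 'cV[R]_2), elliptical P V 0 1%:M psi.

(* The law E_2(0, Id_2, psi) is determined by its characteristic function, so
   Var[V_2 | F_1(V_1) \in A] does not depend on the vector V; [xget] selects
   this common value (and 0 if there is no such law).  The coordinates V_1, V_2
   are those of indices 0 and 1. *)
Definition Kinv (R : realType) (psi : R -> R[i]) (A : set R) : R :=
  xget 0 [set k | exists (d : measure_display) (T : measurableType d)
    (P : probability T R) (V : T -> 'cV[R]_2),
    let V1 := fun w => V w 0 0 in
    let V2 := fun w => V w 1 0 in
    elliptical P V 0 1%:M psi /\
    k = cond_var P [set w | A (df P V1 (V1 w))] V2].

(* Main.v *)
(* A probability on R^n is determined by its characteristic function: the latter
   gives the integrals of trigonometric polynomials, and the indicators of finite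
   intersections of half-spaces {t . x < c} are iterated bounded limits of such
   polynomials, because (1 - u^n)^(n 2^n) tends to 1_{u < 1/2} on [0, 1] and
   sin ((t . x - c) / k) has the sign of t . x - c for large k.  Hence projections
   of X with the same quadratic form u^T Sigma u have the same law, which gives
   Var[X] = Sigma (the normalization E[R^2] = n fixing the scale) and the absence
   of atoms of Y.

   If e is Sigma-orthogonal to a^T, the normalized pair V made of Y and e^T X is a
   spherical vector with generator psi.  Reflecting V_2 shows that e^T (X - mu)
   has conditional mean 0 and is conditionally uncorrelated with Y, and by
   uniqueness of the law its conditional variance is k(B) e^T Sigma e, since
   {F_Y(Y) in F_Y(B_1)} and B differ by a null set: the level sets of F_Y are
   null.  The theorem follows by bilinearity from
   X_i - mu_i = beta_i (Y - E[Y]) + e_i^T (X - mu), with e_i = delta_i - beta_i a^T. *)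
Require Import Defs.
From HB Require Import structures.
From mathcomp Require Import all_boot all_order all_algebra.
From mathcomp Require Import all_classical all_reals all_analysis.
From mathcomp Require Import measurable_realfun.
From mathcomp Require Import complex ring lra.

Set Implicit Arguments.
Unset Strict Implicit.
Unset Printing Implicit Defensive.

Import Order.TTheory GRing.Theory Num.Theory.
Import numFieldNormedType.Exports.

Local Open Scope classical_set_scope.
Local Open Scope ring_scope.

(** * Half-spaces generate the Borel sets of R^n *)

Definition dotc (R : realType) (n : nat) (t x : 'cV[R]_n) : R := (t^T *m x) 0 0.

Section borel_cV.
Context (R : realType) (n : nat).

Lemma dotcE (t x : 'cV[R]_n) : dotc t x = \sum_i t i 0 * x i 0.
Proof. by rewrite /dotc mxE; apply: eq_bigr => i _; rewrite mxE. Qed.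

Lemma measurable_coord (i : 'I_n) :
  measurable_fun [set: borel_cV R n] (fun x : borel_cV R n => x i 0 : R).
Proof.
apply: (measurability _ (RGenOpens.measurableE R)).
move=> _ [_ [a [b ->] <-]]; rewrite setTI; apply: sub_sigma_algebra => /=.
have /continuousP := @coord_continuous R n 1 i 0.
by apply; exact: interval_open.
Qed.

Lemma measurable_dotc (t : 'cV[R]_n) :
  measurable_fun [set: borel_cV R n] (dotc t : borel_cV R n -> R).
Proof.
rewrite (_ : (dotc t : borel_cV R n -> R) =
    (fun x : borel_cV R n => \sum_i t i 0 * (x i 0 : R))); last first.
  by apply/funext => x; rewrite dotcE.
apply: measurable_sum => i; apply: measurable_funM => //.
exact: measurable_coord.
Qed.

(** Lists make the family closed under finite intersection, by concatenation; the empty list gives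
    the whole space. *)
Definition halfspaces (s : seq ('cV[R]_n * R)) : set 'cV[R]_n :=
  [set x | all (fun tc => dotc tc.1 x < tc.2) s].

Lemma halfspaces_cons tc s :
  halfspaces (tc :: s) = [set x | dotc tc.1 x < tc.2] `&` halfspaces s.
Proof. by apply/seteqP; split=> x /= /andP. Qed.

Lemma halfspaces_setI s1 s2 :
  halfspaces s1 `&` halfspaces s2 = halfspaces (s1 ++ s2).
Proof.
by apply/seteqP; rewrite /halfspaces; split=> x /=; rewrite all_cat => /andP.
Qed.

Lemma measurable_halfspaces s : measurable (halfspaces s : set (borel_cV R n)).
Proof.
elim: s => [|tc s ih].
  by rewrite (_ : halfspaces [::] = setT) //; apply/seteqP; split.
rewrite halfspaces_cons; apply: measurableI => //.
rewrite (_ : [set x | _] = dotc tc.1 @^-1` `]-oo, tc.2[).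
  by rewrite -[X in measurable X]setTI; exact: measurable_dotc.
by apply/seteqP; split=> x /=; rewrite in_itv.
Qed.

Lemma dotc_delta i (x : 'cV[R]_n) : dotc (delta_mx i 0) x = x i 0.
Proof.
rewrite dotcE (bigD1 i)//= mxE !eqxx mul1r big1 ?addr0// => j ji.
by rewrite mxE (negbTE ji) mul0r.
Qed.

Lemma dotcN (t x : 'cV[R]_n) : dotc (- t) x = - dotc t x.
Proof. by rewrite !dotcE -sumrN; apply: eq_bigr => i _; rewrite mxE mulNr. Qed.

Lemma dotcD (t u x : 'cV[R]_n) : dotc (t + u) x = dotc t x + dotc u x.
Proof.
by rewrite !dotcE -big_split; apply: eq_bigr => i _; rewrite mxE mulrDl.
Qed.

Lemma dotcZ a (t x : 'cV[R]_n) : dotc (a *: t) x = a * dotc t x.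
Proof. by rewrite !dotcE mulr_sumr; apply: eq_bigr => i _; rewrite mxE mulrA. Qed.

(** Every open set is the union of the open boxes with rational corners that it contains, and such a
    box is an intersection of 2n half-spaces. *)
Lemma borel_halfspaces :
  @measurable _ (borel_cV R n) = <<s range halfspaces >>.
Proof.
apply/seteqP; split; last first.
  apply: smallest_sub; first exact: sigma_algebra_measurable.
  by move=> _ [s _ <-]; exact: measurable_halfspaces.
apply: smallest_sub; first exact: smallest_sigma_algebra.
move=> U oU.
pose box (pq : 'cV[rat]_n * 'cV[rat]_n) : set 'cV[R]_n :=
  [set x : 'cV[R]_n | forall i, ratr (pq.1 i 0) < x i 0 < ratr (pq.2 i 0)].
pose C := [set pq | box pq `<=` U].
(* Boxes that leave [U] are replaced by the empty set, so that the union runs over a whole countable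
   type. *)
rewrite (_ : U = \bigcup_(pq : 'cV[rat]_n * 'cV[rat]_n)
    (if pselect (C pq) then box pq else set0)); last first.
  apply/seteqP; split=> [x Ux|x [pq _]]; last by case: pselect => // Cpq /Cpq.
  have /nbhs_ballP[e /= e0 xeU] : nbhs x U by exact: open_nbhs_nbhs.
  have hp i : exists q : rat, x i 0 - e < ratr q < x i 0.
    have /rat_in_itvoo[q] : x i 0 - e < x i 0 by rewrite ltrBlDr ltrDl.
    by rewrite in_itv; exists q.
  have hq i : exists q : rat, x i 0 < ratr q < x i 0 + e.
    have /rat_in_itvoo[q] : x i 0 < x i 0 + e by rewrite ltrDl.
    by rewrite in_itv; exists q.
  have [p pP] := choice hp; have [q qP] := choice hq.
  exists (\col_i p i, \col_i q i) => //.
  case: pselect => [_ i|]; first by rewrite /= !mxE; have := pP i; have := qP i; lra.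
  case=> y yb; apply: xeU; split=> // i j; rewrite (ord1 j) {j}.
  have := yb i; rewrite !mxE => yi; have := pP i; have := qP i => h1 h2.
  by rewrite /ball /= ltr_norml; lra.
apply: (@countable_bigcupT_measurable _
  (g_sigma_algebraType (range halfspaces))) => [//|pq].
case: (pselect (C pq)) => Cpq; last exact:
  (@measurable0 _ (g_sigma_algebraType (range halfspaces))).
apply: sub_sigma_algebra => /=.
(* Lower bounds on the coordinates are half-spaces with the opposite normals. *)
exists ([seq (- delta_mx i 0, - ratr (pq.1 i 0)) | i <- index_enum 'I_n] ++
        [seq (delta_mx i 0, ratr (pq.2 i 0)) | i <- index_enum 'I_n]) => //.
rewrite -halfspaces_setI /box /halfspaces; apply/seteqP; split=> x /=.
  rewrite !all_map => -[/allP h1 /allP h2] i.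
  have := h1 i (mem_index_enum i); have := h2 i (mem_index_enum i).
  by rewrite /= dotcN dotc_delta ltrN2 => -> ->.
move=> h; rewrite !all_map; split; apply/allP => i _ /=;
  by rewrite ?dotcN dotc_delta ?ltrN2; case/andP: (h i).
Qed.

(** Preimages of half-spaces only involve scalar products, and half-spaces generate the Borel
    sets. *)
Lemma random_vectorP d (T : measurableType d) (X : T -> 'cV[R]_n) :
  (forall t, measurable_fun [set: T] (fun w => dotc t (X w))) ->
  random_vector X.
Proof.
move=> mX; apply: (measurability _ borel_halfspaces).
move=> _ [_ [s _ <-] <-]; rewrite setTI; elim: s => [|tc s ih].
  have -> : X @^-1` halfspaces [::] = setT by apply/seteqP; split.
  exact: measurableT.
rewrite halfspaces_cons preimage_setI; apply: measurableI => //.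
rewrite (_ : X @^-1` _ = (fun w => dotc tc.1 (X w)) @^-1` `]-oo, tc.2[).
  by rewrite -[X in measurable X]setTI; exact: mX.
by apply/seteqP; split=> x /=; rewrite in_itv.
Qed.

End borel_cV.

(** * Trigonometric polynomials *)

Lemma bounded_integrable d (T : measurableType d) (R : realType)
    (P : probability T R) (f : T -> R) (M : R) :
  measurable_fun [set: T] f -> (forall x, `|f x| <= M) ->
  P.-integrable [set: T] (EFin \o f).
Proof.
move=> mf fM; apply: measurable_bounded_integrable => //.
  exact: le_lt_trans (probability_le1 P measurableT) (ltry 1).
exists M; split; first exact: num_real.
by move=> x Mx t _; exact: le_trans (fM t) (ltW Mx).
Qed.

(** * Polynomial approximation of the indicator of [0, 1/2[ on [0, 1] *)

Lemma bernoulli_inequality (R : realDomainType) (v : R) N : -1 <= v ->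
  1 + N%:R * v <= (1 + v) ^+ N.
Proof.
move=> v1; elim: N => [|N ih]; first by rewrite mul0r addr0 expr0.
have h : 0 <= 1 + v by lra.
rewrite exprS; apply: le_trans (ler_wpM2l h ih).
have : 0 <= N%:R * v ^+ 2 by rewrite mulr_ge0// sqr_ge0.
by rewrite -natr1; nra.
Qed.

(** With w = sqrt z, n z^n = (n w^n) w^n: the first factor is bounded, by Bernoulli's inequality for
    1/w - 1, and the second tends to 0. *)
Lemma cvg_natmul_expr (R : realType) (z : R) : 0 <= z < 1 ->
  n%:R * z ^+ n @[n --> \oo] --> (0 : R).
Proof.
case/andP=> z0 z1; have [->|zn0] := eqVneq z 0.
  apply: cvg_near_cst; exists 1%N => // -[|n] //= _.
  by rewrite expr0n mulr0.
have {}z0 : 0 < z by rewrite lt_neqAle eq_sym zn0.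
pose w := Num.sqrt z.
have w0 : 0 < w by rewrite sqrtr_gt0.
have w2 : w ^+ 2 = z by rewrite sqr_sqrtr// ltW.
have w1 : w < 1 by rewrite -(@ltr_pXn2r _ 2)// ?nnegrE ?ltW// w2 expr1n.
have wi : 0 < w^-1 - 1 by rewrite subr_gt0 invf_gt1.
pose C := (w^-1 - 1)^-1.
have hC n : n%:R * w ^+ n <= C.
  rewrite /C -[leRHS]mul1r ler_pdivlMr// -mulrA (mulrC (w ^+ n)) mulrA.
  rewrite -ler_pdivlMr ?exprn_gt0// mul1r -exprVn.
  have := @bernoulli_inequality R (w^-1 - 1) n; rewrite addrCA subrr addr0 => h.
  by apply: le_trans (h _); [rewrite lerDr|lra].
apply: (@squeeze_cvgr _ _ _ _ (fun=> 0) (fun n => C * w ^+ n)).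
- near=> n; rewrite mulr_ge0 ?exprn_ge0 ?(ltW z0)//=.
  rewrite -w2 -exprM mulnC exprM expr2 mulrA.
  by rewrite ler_wpM2r// exprn_ge0// ltW.
- exact: cvg_cst.
- rewrite -[X in _ --> X](mulr0 C); apply: cvgM; first exact: cvg_cst.
  by apply: cvg_expr; rewrite ger0_norm ?ltW.
Unshelve. all: end_near. Qed.

(* Tends on [0, 1] to the indicator of [0, 1/2[; without the factor [n] in the
   exponent, the limit at 1/2 would be 1/e. *)
Definition plateau (R : realType) (n : nat) (u : R) : R :=
  (1 - u ^+ n) ^+ (n * 2 ^ n).

Lemma plateau_itv (R : realType) n (u : R) : 0 <= u <= 1 ->
  0 <= plateau n u <= 1.
Proof.
move=> /andP[u0 u1]; have h : 0 <= u ^+ n <= 1 by rewrite exprn_ge0// exprn_ile1.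
by rewrite /plateau exprn_ge0 ?exprn_ile1//; lra.
Qed.

(** Put N = n 2^n, so that N u^n = n (2u)^n. Below 1/2, Bernoulli's inequality bounds [plateau n u]
    from below by 1 - n (2u)^n, which tends to 1. From 1/2 on, (1 - u^n)^N (1 + u^n)^N <= 1 and (1 +
    u^n)^N >= 1 + n, so [plateau n u] is at most 1/(n + 1). *)
Lemma cvg_plateau (R : realType) (u : R) : 0 <= u <= 1 ->
  plateau n u @[n --> \oo] --> ((u < 2^-1)%R%:R : R).
Proof.
move=> /andP[u0 u1]; have hu n : 0 <= u ^+ n <= 1.
  by rewrite exprn_ge0// exprn_ile1.
have E n : (n * 2 ^ n)%:R * u ^+ n = n%:R * (2 * u) ^+ n :> R.
  by rewrite natrM natrX exprMn mulrA.
case: ltP => [uh|uh].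
  apply: (@squeeze_cvgr _ _ _ _ (fun n => 1 - n%:R * (2 * u) ^+ n) (fun=> 1)).
  - near=> n; rewrite /plateau; apply/andP; split; last first.
      by rewrite exprn_ile1//; have := hu n; lra.
    have := @bernoulli_inequality R (- u ^+ n) (n * 2 ^ n); rewrite mulrN E.
    by apply; have := hu n; lra.
  - rewrite -[X in _ --> X](subr0 1); apply: cvgB; first exact: cvg_cst.
    by apply: cvg_natmul_expr; lra.
  - exact: cvg_cst.
apply: (@squeeze_cvgr _ _ _ _ (fun=> 0) (@harmonic R)).
- near=> n; rewrite /plateau /harmonic.
  have /andP[-> _]/= : 0 <= (1 - u ^+ n) ^+ (n * 2 ^ n) <= 1.
    by apply: plateau_itv; rewrite u0.
  rewrite -[leRHS]mul1r ler_pdivlMr ?ltr0n//.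
  apply: (@le_trans _ _ ((1 - u ^+ n) ^+ (n * 2 ^ n) * (1 + u ^+ n) ^+ (n * 2 ^ n))).
    apply: ler_wpM2l; first by rewrite exprn_ge0//; have := hu n; lra.
    apply: le_trans (@bernoulli_inequality R (u ^+ n) (n * 2 ^ n) _);
      last by have := hu n; lra.
    rewrite E -natr1 addrC lerD2l ler_peMr// exprn_ege1//; lra.
  rewrite -exprMn exprn_ile1//; have := hu n; nra.
- exact: cvg_cst.
- exact: cvg_harmonic.
Unshelve. all: end_near. Qed.

(** The linear span of the functions cos(t . x + b): the phase [b] provides the sines, and t = 0 the
    constants. *)
Inductive trig_poly (R : realType) (n : nat) : ('cV[R]_n -> R) -> Prop :=
| trig_cos t b : trig_poly (fun x => cos (dotc t x + b))
| trig_add f g : trig_poly f -> trig_poly g -> trig_poly (fun x => f x + g x)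
| trig_scale c f : trig_poly f -> trig_poly (fun x => c * f x).

Section trig_poly.
Context (R : realType) (n : nat).
Implicit Types f g : 'cV[R]_n -> R.

Lemma trig_cst c : trig_poly (fun _ : 'cV[R]_n => c).
Proof.
rewrite (_ : (fun _ => c) = (fun x => c * cos (dotc 0 x + 0))).
  exact/trig_scale/trig_cos.
apply/funext => x; rewrite dotcE big1 ?addr0 ?cos0 ?mulr1// => i _.
by rewrite mxE mul0r.
Qed.

(** Product-to-sum formula, 2 cos A cos B = cos(A + B) + cos(A - B), extended by bilinearity. *)
Lemma trig_mul f g : trig_poly f -> trig_poly g -> trig_poly (fun x => f x * g x).
Proof.
move=> tf; elim: tf g => {f} [t b g tg|f1 f2 _ h1 _ h2 g tg|c f _ h g tg].
- elim: tg => {g} [u c|g1 g2 _ h1 _ h2|c g _ h].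
  + rewrite (_ : (fun x => _) = (fun x => 2^-1 * (cos (dotc (t + u) x + (b + c)) +
        cos (dotc (t - u) x + (b - c))))).
      by apply/trig_scale/trig_add; exact: trig_cos.
    apply/funext => x; rewrite !dotcD dotcN.
    rewrite (_ : _ + _ + (b + c) = (dotc t x + b) + (dotc u x + c)); last by ring.
    rewrite (_ : _ - _ + (b - c) = (dotc t x + b) - (dotc u x + c)); last by ring.
    set A := dotc t x + b; set B := dotc u x + c.
    by rewrite cosD cosB; field.
  + under eq_fun do rewrite mulrDr.
    exact: trig_add.
  + under eq_fun do rewrite mulrCA.
    exact: trig_scale.
- under eq_fun do rewrite mulrDl.
  by apply: trig_add; [exact: h1|exact: h2].
- under eq_fun do rewrite -mulrA.
  by apply: trig_scale; exact: h.
Qed.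

Lemma trig_exp f k : trig_poly f -> trig_poly (fun x => f x ^+ k).
Proof.
move=> tf; elim: k => [|k ih]; first exact: trig_cst.
by under eq_fun do rewrite exprS; exact: trig_mul.
Qed.

Lemma trig_prod (I : Type) (s : seq I) (F : I -> 'cV[R]_n -> R) :
  (forall i, trig_poly (F i)) -> trig_poly (fun x => \prod_(i <- s) F i x).
Proof.
move=> tF; elim: s => [|i s ih].
  by under eq_fun do rewrite big_nil; exact: trig_cst.
by under eq_fun do rewrite big_cons; exact: trig_mul.
Qed.

Lemma trig_plateau k f : trig_poly f -> trig_poly (fun x => plateau k (f x)).
Proof.
move=> tf; rewrite /plateau.
under eq_fun do rewrite -mulN1r.
by apply/trig_exp/trig_add; [exact: trig_cst|exact/trig_scale/trig_exp].
Qed.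

Lemma trig_measurable f : trig_poly f -> measurable_fun [set: borel_cV R n] f.
Proof.
elim=> {f} [t b|f g _ mf _ mg|c f _ mf].
- have mc : measurable_fun [set: R] (@cos R).
    by apply: continuous_measurable_fun => x; exact: continuous_cos.
  apply: (measurableT_comp mc); apply: measurable_funD => //.
  exact: measurable_dotc.
- exact: measurable_funD.
- exact: measurable_funM.
Qed.

Lemma trig_bounded f : trig_poly f -> exists M, forall x, `|f x| <= M.
Proof.
elim=> {f} [t b|f g _ [M hM] _ [N hN]|c f _ [M hM]].
- by exists 1 => x; rewrite ler_norml cos_geN1 cos_le1.
- by exists (M + N) => x; exact: le_trans (ler_normD _ _) (lerD (hM x) (hN x)).
- by exists (`|c| * M) => x; rewrite normrM ler_wpM2l.
Qed.

End trig_poly.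

(** * Uniqueness of characteristic functions *)

(** Dominated convergence: the constant [M] is integrable since [P] is finite. *)
Lemma bounded_cvg_Rintegral d (T : measurableType d) (R : realType)
    (P : probability T R) (f_ : nat -> T -> R) (f : T -> R) (M : R) :
  (forall k, measurable_fun [set: T] (f_ k)) ->
  (forall k x, `|f_ k x| <= M) ->
  (forall x, f_ k x @[k --> \oo] --> f x) ->
  \int[P]_x f_ k x @[k --> \oo] --> \int[P]_x f x.
Proof.
move=> mf fM cf.
have mlim : measurable_fun [set: T] f.
  exact: (measurable_fun_cvg mf (fun x _ => cf x)).
have [ilim _ H] : [/\ P.-integrable [set: T] (EFin \o f),
  \int[P]_x `|(EFin \o f_ n) x - (EFin \o f) x| @[n --> \oo] --> 0 &
  \int[P]_x (EFin \o f_ n) x @[n --> \oo] --> \int[P]_x (EFin \o f) x]%E.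
  apply: (@dominated_convergence _ _ _ P _ measurableT _ _ (cst M%:E)).
  - by move=> k; apply/measurable_EFinP.
  - exact/measurable_EFinP.
  - by apply: aeW => x _; apply/fine_cvgP; split; [exact: nearW|exact: cf].
  - exact: (@finite_measure_integrable_cst _ _ _ P _ M measurableT).
  - by apply: aeW => x n _; rewrite lee_fin.
by apply: fine_cvg; rewrite fineK//; exact: integrable_fin_num.
Qed.

Lemma cvg_prod (R : realType) (I : Type) (s : seq I) (F : I -> nat -> R) (G : I -> R) :
  (forall i, F i k @[k --> \oo] --> G i) ->
  \prod_(i <- s) F i k @[k --> \oo] --> \prod_(i <- s) G i.
Proof.
move=> FG; elim: s => [|i s ih].
  by under eq_fun do rewrite big_nil; rewrite big_nil; exact: cvg_cst.
by under eq_fun do rewrite big_cons; rewrite big_cons; exact: cvgM.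
Qed.

Lemma normr_prod_le1 (R : realType) (I : Type) (s : seq I) (F : I -> R) :
  (forall i, 0 <= F i <= 1) -> `|\prod_(i <- s) F i| <= 1.
Proof.
move=> F01; elim: s => [|i s ih]; first by rewrite big_nil normr1.
rewrite big_cons normrM mulr_ile1// ger0_norm; by case/andP: (F01 i).
Qed.

Section cf_unique.
Context (R : realType) (n : nat) (mu nu : probability (borel_cV R n) R).
Hypothesis munu : forall t b,
  \int[mu]_x cos (dotc t x + b) = \int[nu]_x cos (dotc t x + b).

(** This enlarges the class of functions with equal integrals step by step: from trigonometric
    polynomials to indicators of conditions cos < 0, then to indicators of half-spaces. *)
Let eqint_lim (f_ : nat -> 'cV[R]_n -> R) (f : 'cV[R]_n -> R) :
  (forall k, measurable_fun [set: borel_cV R n] (f_ k)) ->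
  (forall k x, `|f_ k x| <= 1) ->
  (forall x, f_ k x @[k --> \oo] --> f x) ->
  (forall k, \int[mu]_x f_ k x = \int[nu]_x f_ k x) ->
  \int[mu]_x f x = \int[nu]_x f x.
Proof.
move=> mf bf cf ef.
have := @bounded_cvg_Rintegral _ _ _ nu f_ f 1 mf bf cf.
under eq_fun do rewrite -ef.
move/(cvg_unique (@Rhausdorff R)).
by move/(_ _ (@bounded_cvg_Rintegral _ _ _ mu f_ f 1 mf bf cf)) => ->.
Qed.

Let eqint_trig (f : 'cV[R]_n -> R) : trig_poly f ->
  \int[mu]_x f x = \int[nu]_x f x.
Proof.
have itrig (P : probability (borel_cV R n) R) g : trig_poly g ->
    P.-integrable [set: borel_cV R n] (EFin \o g).
  move=> tg; have [M gM] := trig_bounded tg.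
  exact: (@bounded_integrable _ (borel_cV R n) _ P g M (trig_measurable tg) gM).
elim=> {f} [t b|f g tf ef tg eg|c f tf ef].
- exact: munu.
- by rewrite !RintegralD ?ef ?eg//; exact: itrig.
- by rewrite !RintegralZl ?ef//; exact: itrig.
Qed.

Let measurable_prod_lt (F : 'cV[R]_n * R -> 'cV[R]_n -> R) s :
  (forall tc, measurable_fun [set: borel_cV R n] (F tc)) ->
  measurable_fun [set: borel_cV R n]
    (fun x : borel_cV R n => \prod_(tc <- s) ((F tc x < 0)%R%:R : R)).
Proof.
move=> mF; apply: measurable_prod => tc _.
rewrite (_ : (fun x => _) = \1_(F tc @^-1` `]-oo, 0[)).
  by apply: measurable_indic; rewrite -[X in measurable X]setTI; exact: mF.
by apply/funext => x; rewrite indicE; congr (nat_of_bool _)%:R; apply/idP/idP;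
  rewrite inE/= in_itv.
Qed.

(** The function (1 + cos)/2 has values in [0, 1] and is below 1/2 exactly where the cosine is
    negative, so products of its plateaus are trigonometric polynomials that tend to the
    integrand. *)
Let eqint_cos s :
  \int[mu]_x \prod_(tb <- s) (cos (dotc tb.1 x + tb.2) < 0)%R%:R =
  \int[nu]_x \prod_(tb <- s) (cos (dotc tb.1 x + tb.2) < 0)%R%:R :> R.
Proof.
pose u (tb : 'cV[R]_n * R) x := 2^-1 * (1 + cos (dotc tb.1 x + tb.2)).
have u01 tb x : 0 <= u tb x <= 1.
  have := cos_geN1 (dotc tb.1 x + tb.2); have := cos_le1 (dotc tb.1 x + tb.2).
  by rewrite /u; lra.
have tu k : trig_poly (fun x => \prod_(tb <- s) plateau k (u tb x)).
  apply: trig_prod => tb; apply/trig_plateau/trig_scale/trig_add.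
    exact: trig_cst.
  exact: trig_cos.
apply: (@eqint_lim (fun k x => \prod_(tb <- s) plateau k (u tb x))).
- by move=> k; exact: trig_measurable.
- by move=> k x; apply: normr_prod_le1 => tb; exact: plateau_itv.
- move=> x; apply: cvg_prod => tb.
  rewrite (_ : (cos (dotc tb.1 x + tb.2) < 0) = (u tb x < 2^-1)).
    exact/cvg_plateau/u01.
  by rewrite /u; apply/idP/idP; lra.
- by move=> k; exact: eqint_trig.
Qed.

(** A phase shift by pi/2 turns the cosine into sin((t . x - c)/(k + 1)). Once |t . x - c|/(k + 1) <
    pi, this sine is negative exactly when t . x < c, so the integrand is a limit of those treated
    by [eqint_cos]. *)
Let eqint_halfspaces s :
  \int[mu]_x \prod_(tc <- s) (dotc tc.1 x < tc.2)%R%:R =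
  \int[nu]_x \prod_(tc <- s) (dotc tc.1 x < tc.2)%R%:R :> R.
Proof.
pose r k : R := k.+1%:R^-1.
pose f k (tc : 'cV[R]_n * R) x :=
  cos (dotc (r k *: tc.1) x + (- (r k * tc.2) - pi / 2)).
have fE k tc x : f k tc x = sin (r k * (dotc tc.1 x - tc.2)).
  by rewrite /f dotcZ addrA cosBpihalf mulrBr.
apply: (@eqint_lim (fun k x => \prod_(tc <- s) (f k tc x < 0)%R%:R)).
- move=> k; apply: measurable_prod_lt => tc.
  apply: trig_measurable; exact: trig_cos.
- move=> k x; apply: normr_prod_le1 => tc.
  by case: (_ < _); rewrite ?lexx ler01.
- move=> x; apply: cvg_prod => tc; apply: cvg_near_cst.
  have pi0 := pi_gt0 R.
  (* The summand 1 keeps the denominator positive even when t . x = c. *)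
  have : \forall k \near \oo, r k < pi / (1 + `|dotc tc.1 x - tc.2|).
    have := @cvg_harmonic R; move/cvgr_lt; apply.
    by apply: divr_gt0; [exact: pi0|rewrite ltr_pwDl].
  apply: filterS => k; rewrite ltr_pdivlMr; last by rewrite ltr_pwDl.
  move=> rk.
  have r0 : 0 < r k by rewrite invr_gt0 ltr0n.
  congr (nat_of_bool _)%:R; rewrite fE; apply/idP/idP => h.
    rewrite ltNge; apply/negP => h2; move: h; apply/negP; rewrite -leNgt.
    apply: sin_ge0_pi; rewrite mulr_ge0 ?subr_ge0//=; last exact: ltW.
    by move: rk; rewrite ger0_norm ?subr_ge0//; nra.
  have h0 : dotc tc.1 x - tc.2 < 0 by rewrite subr_lt0.
  rewrite -oppr_gt0 -sinN -mulrN; apply: sin_gt0_pi.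
  move: rk; rewrite ltr0_norm// => rk; rewrite mulr_gt0 ?oppr_gt0//=.
  by nra.
- move=> k; have := eqint_cos
    [seq (r k *: tc.1, - (r k * tc.2) - pi / 2) | tc <- s].
  by under eq_Rintegral do rewrite big_map;
    under [in X in _ = X -> _]eq_Rintegral do rewrite big_map.
Qed.

(** Finite intersections of half-spaces form a pi-system generating the Borel sets, and their
    probabilities are the integrals in [eqint_halfspaces]. *)
Lemma cf_unique (D : set (borel_cV R n)) : measurable D -> mu D = nu D.
Proof.
move=> mD; apply: (@measure_unique _ R (borel_cV R n) (range (@halfspaces R n))
  (fun=> setT) _ _ _ _ mu nu _ _ D mD).
- exact: borel_halfspaces.
- by move=> _ _ [s1 _ <-] [s2 _ <-]; exists (s1 ++ s2); rewrite ?halfspaces_setI.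
- by move=> _; exists [::] => //; apply/seteqP; split.
- by apply/seteqP; split => // x _; exists 0%N.
- move=> _ [s _ <-].
  have E (P : probability (borel_cV R n) R) :
      \int[P]_x \prod_(tc <- s) ((dotc tc.1 x < tc.2)%R%:R : R) =
      fine (P (halfspaces s)).
    rewrite -[RHS]mul1r -Rintegral_cst; last exact: measurable_halfspaces.
    rewrite [RHS]Rintegral_mkcond; apply: eq_Rintegral => x _; rewrite patchE.
    rewrite (_ : (x \in halfspaces s) =
      all (fun tc => dotc tc.1 x < tc.2) s); last first.
      by apply/idP/idP; rewrite inE.
    elim: s => [|tc s ih]; first by rewrite big_nil.
    by rewrite big_cons ih/=; case: (_ < _); rewrite ?mul1r ?mul0r.
  have := eqint_halfspaces s; rewrite !E => h.
  have fP (P : probability (borel_cV R n) R) : P (halfspaces s) \is a fin_num.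
    exact: fin_num_measure (measurable_halfspaces s).
  exact: etrans (esym (fineK (fP mu))) (etrans (congr1 EFin h) (fineK (fP nu))).
- by move=> _; exact: le_lt_trans (probability_le1 mu measurableT) (ltry 1).
Qed.

End cf_unique.

(** * Laws of random vectors and elliptical vectors *)

Section law.
Context (R : realType) (n : nat).

(** The law is the image measure; the existential hides the bundling of [X] as a measurable function
    and exposes only what is used later. *)
Lemma law_exists d (T : measurableType d) (P : probability T R) (X : T -> 'cV[R]_n) :
  random_vector X ->
  exists mu : probability (borel_cV R n) R,
    (forall D, mu D = P (X @^-1` D)) /\
    forall (D : set (borel_cV R n)) (f : borel_cV R n -> R),
      measurable D -> measurable_fun [set: borel_cV R n] f ->
      (\int[mu]_(x in D) (f x)%:E = \int[P]_(w in X @^-1` D) (f (X w))%:E)%E.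
Proof.
move=> mX.
pose X' : {mfun T >-> borel_cV R n} :=
  HB.pack (X : T -> borel_cV R n) (isMeasurableFun.Build _ _ _ _ _ mX).
exists (distribution P X' : probability _ _); split=> // D f mD mf.
have mfE : measurable_fun D (EFin \o f).
  by apply/measurable_EFinP; exact: measurable_funTS.
(* The change of variables is applied to nonnegative functions, hence the split into positive and
   negative parts. *)
rewrite integralE [RHS]integralE; congr (_ - _)%E.
  rewrite (@ge0_integral_pushforward _ _ _ _ _ X' mX P D (EFin \o f)^\+%E)//;
    first by apply: eq_integral => w _; rewrite /= !funeposE.
  exact: measurable_funepos.
rewrite (@ge0_integral_pushforward _ _ _ _ _ X' mX P D (EFin \o f)^\-%E)//;
    first by apply: eq_integral => w _; rewrite /= !funenegE.
exact: measurable_funeneg.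
Qed.

Lemma eq_law_integral d (T : measurableType d) (P : probability T R) (X : T -> 'cV[R]_n)
    d' (T' : measurableType d') (P' : probability T' R) (X' : T' -> 'cV[R]_n)
    (D : set (borel_cV R n)) (f : borel_cV R n -> R) :
  random_vector X -> random_vector X' -> eq_law P X P' X' ->
  measurable D -> measurable_fun [set: borel_cV R n] f ->
  (\int[P]_(w in X @^-1` D) (f (X w))%:E =
   \int[P']_(w in X' @^-1` D) (f (X' w))%:E)%E.
Proof.
move=> mX mX' XX' mD mf.
have [mu [muE muI]] := law_exists P mX.
have [nu [nuE nuI]] := law_exists P' mX'.
rewrite -muI// -nuI//; apply: eq_measure_integral => A mA _.
by rewrite [LHS]muE [RHS]nuE; exact: XX'.
Qed.

Lemma eq_law_Rintegral d (T : measurableType d) (P : probability T R) (X : T -> 'cV[R]_n)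
    d' (T' : measurableType d') (P' : probability T' R) (X' : T' -> 'cV[R]_n)
    (D : set (borel_cV R n)) (f : borel_cV R n -> R) :
  random_vector X -> random_vector X' -> eq_law P X P' X' ->
  measurable D -> measurable_fun [set: borel_cV R n] f ->
  \int[P]_(w in X @^-1` D) f (X w) = \int[P']_(w in X' @^-1` D) f (X' w).
Proof. by move=> *; congr fine; exact: eq_law_integral. Qed.

Lemma measurable_dotcT d (T : measurableType d) (X : T -> 'cV[R]_n) t :
  random_vector X -> measurable_fun [set: T] (fun w => dotc t (X w)).
Proof.
by move=> mX; apply: (measurableT_comp (measurable_dotc t)); exact: mX.
Qed.

Lemma measurable_cosD (b : R) : measurable_fun [set: R] (fun y => cos (y + b)).
Proof.
apply: continuous_measurable_fun => x.
apply: (@continuous_comp _ _ _ (fun y => y + b) (@cos R)); last exact: continuous_cos.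
by apply: cvgD; [exact: cvg_id|exact: cvg_cst].
Qed.

(** By the addition formula, cos(t . x + b) is a combination of cos(t . x) and sin(t . x), which
    gives the hypothesis of [cf_unique]. *)
Lemma eq_law_cf d (T : measurableType d) (P : probability T R) (X : T -> 'cV[R]_n)
    d' (T' : measurableType d') (P' : probability T' R) (X' : T' -> 'cV[R]_n) :
  random_vector X -> random_vector X' ->
  (forall t, \int[P]_w cos (dotc t (X w)) = \int[P']_w cos (dotc t (X' w))) ->
  (forall t, \int[P]_w sin (dotc t (X w)) = \int[P']_w sin (dotc t (X' w))) ->
  eq_law P X P' X'.
Proof.
move=> mX mX' hc hs.
have [mu [muE muI]] := law_exists P mX.
have [nu [nuE nuI]] := law_exists P' mX'.
move=> D mD; rewrite -muE -nuE; apply: cf_unique mD => t b.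
have mc : measurable_fun [set: borel_cV R n]
    (fun x : borel_cV R n => cos (dotc t x + b)).
  by apply: (measurableT_comp (measurable_cosD b)); exact: measurable_dotc.
rewrite /Rintegral muI// nuI// !preimage_setT.
have key d1 (T1 : measurableType d1) (P1 : probability T1 R) (X1 : T1 -> 'cV[R]_n) :
    random_vector X1 ->
    \int[P1]_w cos (dotc t (X1 w) + b) =
    cos b * \int[P1]_w cos (dotc t (X1 w)) - sin b * \int[P1]_w sin (dotc t (X1 w)).
  move=> mX1.
  have mcos : measurable_fun [set: T1] (fun w => cos (dotc t (X1 w))).
    apply: (@measurableT_comp _ _ _ _ _ _ (@cos R)).
      by apply: continuous_measurable_fun; exact: continuous_cos.
    exact: measurable_dotcT.
  have msin : measurable_fun [set: T1] (fun w => sin (dotc t (X1 w))).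
    apply: (@measurableT_comp _ _ _ _ _ _ (@sin R)).
      by apply: continuous_measurable_fun; exact: continuous_sin.
    exact: measurable_dotcT.
  have icos : P1.-integrable [set: T1] (EFin \o (fun w => cos (dotc t (X1 w)))).
    by apply: (@bounded_integrable _ _ _ _ _ 1) => [//|x]; rewrite ler_norml cos_geN1 cos_le1.
  have isin : P1.-integrable [set: T1] (EFin \o (fun w => sin (dotc t (X1 w)))).
    by apply: (@bounded_integrable _ _ _ _ _ 1) => [//|x]; rewrite ler_norml sin_geN1 sin_le1.
  rewrite -!RintegralZl// -RintegralB//; last 2 first.
    exact: (integrableZl measurableT (cos b) icos).
    exact: (integrableZl measurableT (sin b) isin).
  by apply: eq_Rintegral => w _; rewrite cosD mulrC [X in _ - X]mulrC.
have := key _ _ P _ mX; rewrite hc hs -(key _ _ P' _ mX').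
by [].
Qed.

End law.

(** * Elliptical vectors: real form, affine images, uniqueness in law *)

Section elliptical.
Context (R : realType).

(** Real and imaginary parts are separated; the minus sign comes from the convention exp(- i t). *)
Lemma ellipticalP n d (T : measurableType d) (P : probability T R)
    (X : T -> 'cV[R]_n) mu Sigma psi :
  elliptical P X mu Sigma psi <->
  random_vector X /\ forall t,
    \int[P]_w cos (dotc t (X w - mu)) = complex.Re (psi (dotc t (Sigma *m t))) /\
    \int[P]_w sin (dotc t (X w - mu)) = - complex.Im (psi (dotc t (Sigma *m t))).
Proof.
have E t : cexpectation P (fun w => expNi ((t^T *m (X w - mu)) 0 0)) =
    (\int[P]_w cos (dotc t (X w - mu)) +i* \int[P]_w - sin (dotc t (X w - mu)))%C.
  by rewrite /cexpectation unlock.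
have S : random_vector X ->  forall t,
    \int[P]_w - sin (dotc t (X w - mu)) = - \int[P]_w sin (dotc t (X w - mu)).
  move=> mX t; rewrite -mulN1r -RintegralZl//.
    by apply: eq_Rintegral => w _; rewrite mulN1r.
  apply: (@bounded_integrable _ _ _ _ _ 1) => [|x]; last first.
    by rewrite ler_norml sin_geN1 sin_le1.
  apply: (@measurableT_comp _ _ _ _ _ _ (@sin R)).
    by apply: continuous_measurable_fun; exact: continuous_sin.
  under eq_fun do rewrite /dotc mulmxBr !mxE.
  apply: measurable_funB => //.
  by have := measurable_dotcT t mX; under eq_fun do rewrite /dotc mxE.
split=> -[mX h]; split=> // t.
  have := h t; rewrite E S// -mulmxA -/(dotc _ _).
  by case: (psi _) => a b [<- <-]; rewrite /= opprK.
rewrite E S// -mulmxA -/(dotc _ _).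
by have [-> ->] := h t; rewrite opprK; case: (psi _).
Qed.

Lemma dotc_mulmx m n (A : 'M[R]_(m, n)) t x : dotc t (A *m x) = dotc (A^T *m t) x.
Proof. by rewrite /dotc trmx_mul trmxK mulmxA. Qed.

Lemma dotcDr n (t x y : 'cV[R]_n) : dotc t (x + y) = dotc t x + dotc t y.
Proof. by rewrite /dotc mulmxDr mxE. Qed.

Lemma dotcBr n (t x y : 'cV[R]_n) : dotc t (x - y) = dotc t x - dotc t y.
Proof. by rewrite /dotc mulmxBr !mxE. Qed.

Lemma random_vector_affine m n d (T : measurableType d) (X : T -> 'cV[R]_n)
    (A : 'M[R]_(m, n)) c :
  random_vector X -> random_vector (fun w => A *m X w + c).
Proof.
move=> mX; apply: random_vectorP => t.
under eq_fun do rewrite dotcDr dotc_mulmx.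
by apply: measurable_funD => //; exact: measurable_dotcT.
Qed.

(** Since t . (A x) = (A^T t) . x, the characteristic function of the image is the original one at
    A^T t. *)
Lemma elliptical_affine m n d (T : measurableType d) (P : probability T R)
    (X : T -> 'cV[R]_n) mu Sigma psi (A : 'M[R]_(m, n)) c :
  elliptical P X mu Sigma psi ->
  elliptical P (fun w => A *m X w + c) (A *m mu + c) (A *m Sigma *m A^T) psi.
Proof.
move/ellipticalP=> [mX h]; apply/ellipticalP; split.
  exact: random_vector_affine.
move=> t; have [hc hs] := h (A^T *m t).
rewrite -!mulmxA dotc_mulmx -hc -hs.
by split; apply: eq_Rintegral => w _;
  rewrite [A *m mu + c]addrC addrKA -mulmxBr dotc_mulmx.
Qed.

Lemma elliptical_eq_law n d (T : measurableType d) (P : probability T R)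
    (X : T -> 'cV[R]_n) d' (T' : measurableType d') (P' : probability T' R)
    (X' : T' -> 'cV[R]_n) Sigma psi :
  elliptical P X 0 Sigma psi -> elliptical P' X' 0 Sigma psi ->
  eq_law P X P' X'.
Proof.
move=> /ellipticalP[mX h] /ellipticalP[mX' h']; apply: eq_law_cf => // t.
  have [+ _] := h t; have [<- _] := h' t.
  by under eq_Rintegral do rewrite subr0;
    under [in X in _ = X -> _]eq_Rintegral do rewrite subr0.
have [_ +] := h t; have [_ <-] := h' t.
by under eq_Rintegral do rewrite subr0;
    under [in X in _ = X -> _]eq_Rintegral do rewrite subr0.
Qed.

End elliptical.

(** * Second moments of projections *)

Section square_integrable.
Context d (T : measurableType d) (R : realType) (P : probability T R).
Implicit Types f g : T -> R.

Definition sqint f := measurable_fun [set: T] f /\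
  P.-integrable [set: T] (EFin \o (fun w => f w ^+ 2)).

(** Domination: |f g| <= f^2 + g^2. *)
Lemma sqintM f g : sqint f -> sqint g ->
  P.-integrable [set: T] (EFin \o (fun w => f w * g w)).
Proof.
move=> [mf if2] [mg ig2].
have := integrableD measurableT if2 ig2; apply: le_integrable => //.
  by apply/measurable_EFinP; exact: measurable_funM.
move=> w _ /=; rewrite lee_fin (ger0_norm (addr_ge0 (sqr_ge0 _) (sqr_ge0 _))).
have := sqr_ge0 (f w - g w); have := sqr_ge0 (f w + g w).
by rewrite ler_norml; nra.
Qed.

Lemma sqint_cst c : sqint (cst c).
Proof.
split => //; have := @finite_measure_integrable_cst _ _ _ P _ (c ^+ 2) measurableT.
exact.
Qed.

Lemma sqint_integrable f : sqint f -> P.-integrable [set: T] (EFin \o f).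
Proof.
move=> sf; have := sqintM sf (sqint_cst 1).
by congr (_.-integrable _ _); apply/funext => w /=; rewrite mulr1.
Qed.

Lemma sqintZ c f : sqint f -> sqint (fun w => c * f w).
Proof.
move=> [mf if2]; split; first exact: measurable_funM.
have := integrableZl measurableT (c ^+ 2) if2.
by congr (_.-integrable _ _); apply/funext => w /=; rewrite exprMn EFinM.
Qed.

Lemma sqintD f g : sqint f -> sqint g -> sqint (fun w => f w + g w).
Proof.
move=> sf sg; have [mf if2] := sf; have [mg ig2] := sg.
split; first exact: measurable_funD.
have ifg := integrableZl measurableT 2 (sqintM sf sg).
have := integrableD measurableT (integrableD measurableT if2 ig2) ifg.
congr (_.-integrable _ _); apply/funext => w /=.
by rewrite -!EFinM -!EFinD; congr EFin; ring.
Qed.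

End square_integrable.

(** * The bilinear form defined by the scatter matrix *)

Definition qform (R : realType) n (S : 'M[R]_n) (u v : 'cV[R]_n) := dotc u (S *m v).

Section qform.
Context (R : realType) (n : nat) (S : 'M[R]_n).
Implicit Types u v w : 'cV[R]_n.

Lemma qformDl u v w : qform S (u + v) w = qform S u w + qform S v w.
Proof. exact: dotcD. Qed.

Lemma qformZl c u w : qform S (c *: u) w = c * qform S u w.
Proof. exact: dotcZ. Qed.

Lemma dotcC u v : dotc u v = dotc v u.
Proof. by rewrite !dotcE; apply: eq_bigr => i _; rewrite mulrC. Qed.

Lemma qformC u v : S^T = S -> qform S u v = qform S v u.
Proof. by move=> sS; rewrite /qform dotc_mulmx sS dotcC. Qed.

Lemma qform_delta i j : qform S (delta_mx i 0) (delta_mx j 0) = S i j.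
Proof. by rewrite /qform dotc_delta -colE mxE. Qed.

End qform.

Section second_moment.
Context d (T : measurableType d) (R : realType) (P : probability T R) (n : nat)
  (X : T -> 'cV[R]_n) (mu : 'cV[R]_n) (Sigma : 'M[R]_n) (psi : R -> R[i]).
Hypothesis hX : elliptical P X mu Sigma psi.
Hypothesis hSigma : posdef_mx Sigma.

Notation Z u := (fun w => dotc u (X w - mu)).
Notation q := (qform Sigma).

Let mX : random_vector X. Proof. by case: hX. Qed.

Lemma qform_gt0 u : u != 0 -> 0 < q u u.
Proof. by case: hSigma => _ h /h; rewrite -mulmxA. Qed.

Lemma qform_ge0 u : 0 <= q u u.
Proof.
have [->|/qform_gt0/ltW//] := eqVneq u 0.
by rewrite /qform mulmx0 dotcE big1// => i _; rewrite mxE mul0r.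
Qed.

Lemma measurable_Z u : measurable_fun [set: T] (Z u).
Proof.
under eq_fun do rewrite dotcDr.
by apply: measurable_funD => //; exact: measurable_dotcT.
Qed.

(** The centred projection along [u] is a one-dimensional elliptical vector with scatter [q u u], so
    its law depends on [u] only through that number. Extended integrals make this available before
    any integrability is known. *)
Lemma projection_law (g : R -> R) u v : measurable_fun [set: R] g ->
  q u u = q v v ->
  (\int[P]_w (g (Z u w))%:E = \int[P]_w (g (Z v w))%:E)%E.
Proof.
move=> mg quv.
pose V (t : 'cV[R]_n) (w : T) : 'cV[R]_1 := t^T *m X w - t^T *m mu.
have eV t : elliptical P (V t) 0 (t^T *m Sigma *m t) psi.
  by have := elliptical_affine t^T (- (t^T *m mu)) hX; rewrite subrr trmxK.
have VE t w : V t w 0 0 = Z t w by rewrite /V -mulmxBr.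
have tS t : t^T *m Sigma *m t = (q t t)%:M.
  by rewrite [LHS]mx11_scalar -mulmxA.
have uv : eq_law P (V u) P (V v).
  apply: (@elliptical_eq_law _ _ _ _ _ _ _ _ _ _ (u^T *m Sigma *m u)) => //.
  by rewrite tS quv -tS; exact: eV.
have mg' : measurable_fun [set: borel_cV R 1] (fun x : borel_cV R 1 => g (x 0 0)).
  by apply: (measurableT_comp mg); exact: measurable_coord.
have rV t : random_vector (V t) by case: (eV t).
have := eq_law_integral (rV u) (rV v) uv (@measurableT _ _) mg'.
rewrite !preimage_setT; under eq_integral do rewrite VE.
by under [in X in _ = X -> _]eq_integral do rewrite VE.
Qed.

Hypothesis hrepr : stochastic_repr P X mu Sigma.

(** Take for b_i the transposed rows of A^-1; they are unit vectors because Sigma = A A^T. In the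
    representation, b_i . (X - mu) becomes rho U_i, so the squares add up to rho^2 |U|^2 = rho^2
    almost surely, of mean n. *)
Lemma unit_basis_moment : exists b : 'I_n -> 'cV[R]_n,
  (forall i, q (b i) (b i) = 1) /\
  (\int[P]_w (\sum_i (Z (b i) w) ^+ 2)%:E = (n%:R)%:E)%E.
Proof.
case: hrepr => d' [T' [P' [rho [A [U [[mrho rho0 rho2] [uA AA] [mU U1 _] _ eqXU]]]]]].
exists (fun i => (invmx A)^T *m delta_mx i 0); split => [i|].
  rewrite /qform -dotc_mulmx -AA -mulmxA mulKmx// mulmxA -trmx_mul mulVmx//.
  by rewrite trmx1 mul1mx dotc_delta mxE !eqxx.
pose b (i : 'I_n) : 'cV[R]_n := (invmx A)^T *m delta_mx i 0.
have bE i x : dotc (b i) x = (invmx A *m x) i 0.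
  by rewrite -dotc_mulmx dotc_delta.
pose f (x : borel_cV R n) := \sum_i (dotc (b i) ((x : 'cV_n) - mu)) ^+ 2.
have mf : measurable_fun [set: borel_cV R n] f.
  apply: measurable_sum => i; apply: measurable_funX.
  under eq_fun do rewrite dotcDr.
  by apply: measurable_funD => //; exact: measurable_dotc.
have mX' : random_vector (fun w => mu + rho w *: (A *m U w)).
  apply: random_vectorP => t; under eq_fun do rewrite dotcDr.
  apply: measurable_funD => //.
  under eq_fun do rewrite dotcC dotcZ dotcC dotc_mulmx.
  by apply: measurable_funM => //; exact: measurable_dotcT.
have := eq_law_integral mX mX' eqXU (@measurableT _ _) mf.
rewrite !preimage_setT /f => ->.
rewrite -rho2 expectation.unlock.
(* The two integrands agree where |U| = 1, an event of probability 1. *)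
apply: ae_eq_integral => //.
- apply/measurable_EFinP.
  exact: (measurableT_comp mf).
- by apply/measurable_EFinP; exact: measurable_funX.
- have mE : measurable [set w | \sum_i U w i 0 ^+ 2 = 1].
    pose h (x : borel_cV R n) := \sum_i (x i 0 : R) ^+ 2.
    have mh : measurable_fun [set: T'] (fun w => h (U w)).
      apply: (@measurableT_comp _ _ _ _ _ _ h) => //.
      by apply: measurable_sum => i; apply: measurable_funX; exact: measurable_coord.
    have := mh measurableT [set 1]; rewrite setTI; exact.
  exists (~` [set w | \sum_i U w i 0 ^+ 2 = 1]); split.
  + exact: measurableC.
  + have := probability_setC P' mE; rewrite U1 -EFinB subrr; exact.
  + move=> w /=; apply: contra_not => Uw _; congr EFin.
    rewrite -[RHS]mulr1 -Uw mulr_sumr; apply: eq_bigr => i _.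
    by rewrite bE addrC addKr -scalemxAr mulmxA mulVmx// mul1mx mxE exprMn.
Qed.

(** By [projection_law] the n directions b_i share one second moment m, and n m = n gives m = 1. The
    projection along [u] has the law of the one along sqrt(q u u) b_0, which fixes its second
    moment. *)
Lemma projection_sqmoment u : (\int[P]_w ((Z u w) ^+ 2)%:E = (q u u)%:E)%E.
Proof.
have [b [qb intb]] := unit_basis_moment.
(* In dimension 0 there is no direction b_0 to compare with, and all projections vanish. *)
have [n0|n_gt0] := posnP n.
  have E0 x : dotc u x = 0.
    by rewrite dotcE big1// => i _; have := ltn_ord i; rewrite [X in (_ < X)%N]n0.
  rewrite /qform E0; under eq_integral do rewrite E0 expr0n/=.
  by rewrite integral0.
pose i0 : 'I_n := Ordinal n_gt0.
have msq : measurable_fun [set: R] (fun y : R => y ^+ 2).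
  exact: measurable_funX.
pose m := (\int[P]_w ((Z (b i0) w) ^+ 2)%:E)%E.
have m1 : m = 1%E.
  have mge0 : (0 <= m)%E by apply: integral_ge0 => w _; rewrite lee_fin sqr_ge0.
  move: intb; under eq_integral do rewrite -sumEFin.
  rewrite ge0_integral_sum//; last 2 first.
  - move=> i; apply/measurable_EFinP; apply: measurable_funX.
    exact: measurable_Z.
  - by move=> i w _; rewrite lee_fin sqr_ge0.
  rewrite (eq_bigr (fun=> m)); last first.
    by move=> i _; apply: (projection_law msq); rewrite !qb.
  (* As an extended real, m could be infinite; the sum would then be infinite, whereas it equals
     n. *)
  case: m mge0 => [r| |]; rewrite ?leeNy_eq//.
    rewrite lee_fin => r0; rewrite sumEFin => -[].
    rewrite sumr_const card_ord -[X in X = _]mulr_natr => /(congr1 (fun x => x / n%:R)).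
    by rewrite mulfK ?divff ?pnatr_eq0 -?lt0n// => ->.
  by rewrite (bigD1 i0)//= addye// -ltNye; apply: lt_le_trans (sume_ge0 _ _).
have -> : (q u u)%:E = ((q u u)%:E * m)%E by rewrite m1 mule1.
rewrite -ge0_integralZl//; last 3 first.
- by apply/measurable_EFinP; apply: measurable_funX; exact: measurable_Z.
- by move=> w _; rewrite lee_fin sqr_ge0.
- by rewrite lee_fin qform_ge0.
have qs : Num.sqrt (q u u) ^+ 2 = q u u by rewrite sqr_sqrtr// qform_ge0.
rewrite (projection_law msq (v := Num.sqrt (q u u) *: b i0)).
  by apply: eq_integral => w _; rewrite dotcZ exprMn qs.
rewrite qformZl [X in _ = _ * X]qformC; last by case: hSigma.
by rewrite qformZl qb mulr1 -expr2 qs.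
Qed.

Lemma sqint_projection u : sqint P (Z u).
Proof.
split; first exact: measurable_Z.
apply/integrableP; split.
  by apply/measurable_EFinP; apply: measurable_funX; exact: measurable_Z.
under eq_integral do rewrite /= ger0_norm ?sqr_ge0//.
by rewrite projection_sqmoment ltry.
Qed.

(** The projections along u and -u have the same law and are opposite, so the mean is its own
    opposite. *)
Lemma projection_mean0 u : \int[P]_w Z u w = 0.
Proof.
have qN : q u u = q (- u) (- u).
  by rewrite /qform dotcN mulmxN [in RHS]dotcC dotcN dotcC opprK.
have := projection_law (@measurable_id _ R setT) qN.
move/(congr1 fine); rewrite -[LHS]/(\int[P]_w Z u w) -[RHS]/(\int[P]_w Z (- u) w).
under [in X in _ = X -> _]eq_Rintegral do rewrite dotcN -mulN1r.
rewrite RintegralZl//; first by lra.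
exact/sqint_integrable/sqint_projection.
Qed.

(** Polarization of the second moment along u + v. *)
Lemma projection_cov u v : \int[P]_w (Z u w * Z v w) = q u v.
Proof.
have s t : sqint P (Z t) by exact: sqint_projection.
have E t : \int[P]_w (Z t w) ^+ 2 = q t t.
  by rewrite /Rintegral projection_sqmoment.
have I t : P.-integrable [set: T] (EFin \o (fun w => Z t w ^+ 2)) by case: (s t).
have Iuv := sqintM (s u) (s v).
have := E (u + v).
have -> : \int[P]_w (Z (u + v) w) ^+ 2 =
    \int[P]_w ((Z u w ^+ 2 + Z v w ^+ 2) + 2 * (Z u w * Z v w)).
  by apply: eq_Rintegral => w _; rewrite dotcD; ring.
rewrite RintegralD//; last 2 first.
- exact: (integrableD measurableT (I u) (I v)).
- exact: (integrableZl measurableT 2 Iuv).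
rewrite RintegralD// RintegralZl// !E qformDl.
rewrite ![q _ (u + v)]qformC ?qformDl; [|by case: hSigma..].
by rewrite (qformC v u); [lra|by case: hSigma].
Qed.

Lemma projection_mean u : \int[P]_w dotc u (X w) = dotc u mu.
Proof.
have -> : \int[P]_w dotc u (X w) = \int[P]_w (Z u w + cst (dotc u mu) w).
  by apply: eq_Rintegral => w _; rewrite /= -dotcDr subrK.
rewrite RintegralD//; last 2 first.
- exact/sqint_integrable/sqint_projection.
- exact/sqint_integrable/sqint_cst.
rewrite projection_mean0 add0r Rintegral_cst//.
by rewrite [X in fine X](_ : _ = 1%E) ?mulr1//; exact: probability_setT.
Qed.

Lemma projection_covariance u v :
  fine (covariance P (fun w => dotc u (X w)) (fun w => dotc v (X w))) = q u v.
Proof.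
have E t : fine 'E_P[fun w => dotc t (X w)] = dotc t mu.
  by rewrite expectation.unlock; exact: projection_mean.
rewrite covariance.unlock !E expectation.unlock -projection_cov.
congr fine; apply: eq_integral => w _ /=.
by rewrite !dotcBr.
Qed.

End second_moment.

(** * Level sets of a continuous distribution function *)

(** Reindexing by [pickle] reduces this to a union over the natural numbers. *)
Lemma negligible_bigcup_countType (I : countType) d (T : measurableType d)
    (R : realType) (mu : {measure set T -> \bar R}) (F : I -> set T) :
  (forall i, mu.-negligible (F i)) -> mu.-negligible (\bigcup_i F i).
Proof.
move=> nF; pose G k := oapp F set0 (unpickle k).
apply: (@negligibleS _ _ _ _ (\bigcup_k G k)).
  by move=> w [i _ Fw]; exists (pickle i) => //; rewrite /G pickleK.
apply: negligible_bigcup => k; rewrite /G; case: unpickle => [i|] /=.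
  exact: nF.
exact: negligible_set0.
Qed.

Section level_sets.
Context d (T : measurableType d) (R : realType) (P : probability T R) (Y : T -> R).
Hypothesis mY : measurable_fun [set: T] Y.
Hypothesis Y_atomless : forall c, P (Y @^-1` [set c]) = 0%E.

Notation F := (df P Y).

Let mpre (D : set R) : measurable D -> measurable (Y @^-1` D).
Proof. by move=> mD; rewrite -[X in measurable X]setTI; exact: mY. Qed.

Lemma df_EFin r : (F r)%:E = P (Y @^-1` `]-oo, r]).
Proof. by rewrite /df fineK// fin_num_measure//; exact: mpre. Qed.

Lemma df_nondecreasing : {homo F : x y / x <= y}.
Proof.
move=> x y xy; rewrite -lee_fin !df_EFin; apply: le_measure; rewrite ?inE.
- exact: mpre.
- exact: mpre.
- by move=> w /=; rewrite !in_itv/= => /le_trans; apply.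
Qed.

Lemma measurable_df : measurable_fun [set: R] F.
Proof. by apply: nondecreasing_measurable => //; exact: df_nondecreasing. Qed.

Lemma df_itv r : 0 <= F r <= 1.
Proof.
by rewrite -!lee_fin df_EFin measure_ge0 probability_le1//; exact: mpre.
Qed.

(** For p < q, the probability of p < Y <= q is the increment F q - F p. *)
Lemma negligible_flat p q : F p = F q -> P.-negligible (Y @^-1` `]p, q]).
Proof.
move=> Fpq; apply/negligibleP; first exact: mpre.
have [qp|pq] := leP q p.
  by rewrite (_ : _ @^-1` _ = set0) ?measure0// set_itv_ge// bnd_simp -leNgt.
have : P (Y @^-1` `]-oo, q]) = (P (Y @^-1` `]-oo, p]) + P (Y @^-1` `]p, q]))%E.
  rewrite -measureU; [|exact: mpre|exact: mpre|].
    congr (P _); rewrite -preimage_setU; congr (_ @^-1` _).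
    apply/seteqP; split => x /=; rewrite !in_itv/=.
      by move=> ->; case: (leP x p) => _; [left|right].
    by case=> [/le_trans|/andP[]//]; apply; exact: ltW.
  rewrite -preimage_setI (_ : _ `&` _ = set0) ?preimage_set0//.
  apply/seteqP; split => x //=; rewrite !in_itv/= => -[xp /andP[px _]].
  by move: px; rewrite ltNge xp.
rewrite -!df_EFin Fpq => /eqP; rewrite -[eqbLHS]adde0 eq_sym.
have fP : P (Y @^-1` `]p, q]) \is a fin_num by rewrite fin_num_measure//; exact: mpre.
rewrite -(fineK fP) -!EFinD eqe (inj_eq (addrI _)) => /eqP h.
by apply: etrans (esym (fineK fP)) _; rewrite h.
Qed.

(* The rational flat pieces of F cover {F = c} up to at most two points. *)
Lemma negligible_level c : P.-negligible (Y @^-1` [set r | F r = c]).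
Proof.
pose flat (pq : rat * rat) :=
  if F (ratr pq.1) == F (ratr pq.2) then `]ratr pq.1, ratr pq.2]%classic else set0 : set R.
pose N := \bigcup_pq Y @^-1` flat pq.
have negN : P.-negligible N.
  apply: negligible_bigcup_countType => pq; rewrite /flat.
  by case: eqP => [/negligible_flat//|_]; rewrite preimage_set0; exact: negligible_set0.
pose K := [set r | F r = c] `\` \bigcup_pq flat pq.
(* Of three points of [K], the middle one would lie in the flat piece delimited by rationals chosen
   on either side of it. *)
have no3 x y z : K x -> K y -> K z -> x < y -> y < z -> False.
  move=> [/= Fx _] [/= Fy nK] [/= Fz _] xy yz; apply: nK.
  have [p] := rat_in_itvoo xy; have [q] := rat_in_itvoo yz.
  rewrite !in_itv/= => /andP[yq qz] /andP[xp py].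
  exists (p, q) => //; rewrite /flat/= ifT.
    by rewrite /= in_itv/= py ltW.
  apply/eqP; apply: le_anti; apply/andP; split.
    by apply: df_nondecreasing; rewrite ltW// (lt_trans py).
  apply: (@le_trans _ _ c); first by rewrite -Fz; apply/df_nondecreasing/ltW.
  by rewrite -Fx; apply/df_nondecreasing/ltW.
have negpt r : P.-negligible (Y @^-1` [set r]).
  by apply/negligibleP; [exact: mpre|exact: Y_atomless].
have sub x y : K `<=` [set x] `|` [set y] -> P.-negligible (Y @^-1` [set r | F r = c]).
  move=> Kxy; apply: negligibleS (negligibleU negN (negligibleU (negpt x) (negpt y))).
  move=> w /= Fw; have [|nN] := pselect (N w); first by left.
  right; apply: Kxy; split; first exact: Fw.
  by move=> /= h; apply: nN; case: h => pq _ Hpq; exists pq.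
have [[x Kx]|nK] := pselect (exists x, K x); last first.
  by apply: (sub 0 0) => r Kr; exfalso; apply: nK; exists r.
have [[y [Ky yx]]|nK] := pselect (exists y, K y /\ y != x); last first.
  apply: (sub x x) => r Kr; left; apply: contrapT => /eqP rx; apply: nK.
  by exists r.
apply: (sub x y) => z Kz; apply: contrapT => /not_orP[/eqP zx /eqP zy].
have [xy|xy|xy] := ltgtP x y; last by rewrite xy eqxx in yx.
- have [xz|xz|xz] := ltgtP x z; last by rewrite xz eqxx in zx.
    have [yz|yz|yz] := ltgtP y z; last by rewrite yz eqxx in zy.
      exact: (no3 x y z).
    exact: (no3 x z y).
  exact: (no3 z x y).
- have [xz|xz|xz] := ltgtP x z; last by rewrite xz eqxx in zx.
    exact: (no3 y x z).
  have [yz|yz|yz] := ltgtP y z; last by rewrite yz eqxx in zy.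
    exact: (no3 y z x).
  exact: (no3 z y x).
Qed.

(** If F b = F r with b <> r, then F is constant between b and r and takes this value at a rational.
    So F r lies in F(B1) exactly when r is in B1 or in one of countably many level sets, which gives
    measurability; level sets are null. The levels 0 and 1, cut off by ]0, 1[, are null as well. *)
Lemma df_saturation (B1 : set R) : measurable B1 ->
  let S := [set r | (F @` B1 `&` `]0, 1[) (F r)] in
  measurable S /\
  exists N, [/\ measurable N, P N = 0%E &
    forall w, ~ N w -> S (Y w) <-> B1 (Y w)].
Proof.
move=> mB1 S.
pose L c := [set r | F r = c].
have mL c : measurable (L c).
  by have := measurable_df measurableT (measurable_set1 c); rewrite setTI.
pose LQ (t : rat) := [set r | (F @` B1) (F (ratr t)) /\ F r = F (ratr t)].
have imE r : (F @` B1) (F r) <-> B1 r \/ (\bigcup_t LQ t) r.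
  split => [[b B1b Fb]|[B1r|[t _ [h ->]]//]]; last by exists r.
  have flat t : F (ratr t) = F r -> (\bigcup_t LQ t) r.
    by move=> Ft; exists t => //; split; [rewrite Ft; exists b|].
  have [br|br|<-] := ltgtP b r; [| |by left]; right.
    have [t] := rat_in_itvoo br; rewrite in_itv/= => /andP[bt tr].
    apply: (flat t); apply: le_anti; rewrite -{2}Fb; apply/andP; split;
      by apply/df_nondecreasing; exact: ltW.
  have [t] := rat_in_itvoo br; rewrite in_itv/= => /andP[rt tb].
  apply: (flat t); apply: le_anti; rewrite -{1}Fb; apply/andP; split;
    by apply/df_nondecreasing; exact: ltW.
split.
  rewrite (_ : S = (B1 `|` \bigcup_t LQ t) `&` F @^-1` `]0, 1[); last first.
    by apply/seteqP; split => r [/imE].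
  apply: measurableI.
    apply: measurableU => //; apply: bigcupT_measurable_rat => t.
    have [h|h] := pselect ((F @` B1) (F (ratr t))).
      by rewrite (_ : LQ t = L (F (ratr t)))//; apply/seteqP; split => r // [].
    by rewrite (_ : LQ t = set0)//; apply/seteqP; split => r // [].
  by have := measurable_df measurableT (measurable_itv `]0, 1[); rewrite setTI.
have : P.-negligible (\bigcup_(t : rat) Y @^-1` L (F (ratr t)) `|`
    (Y @^-1` L 0 `|` Y @^-1` L 1)).
  apply: negligibleU.
    by apply: negligible_bigcup_countType => t; exact: negligible_level.
  by apply: negligibleU; exact: negligible_level.
case=> N [mN N0 sN]; exists N; split => // w nN.
have {sN}nN' : ~ (\bigcup_(t : rat) Y @^-1` L (F (ratr t)) `|`
    (Y @^-1` L 0 `|` Y @^-1` L 1)) w by move/sN.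
split=> [[/imE[//|[t _ [_ Lw]]] _]|B1w].
  by exfalso; apply: nN'; left; exists t.
split; first by apply/imE; left.
rewrite /= in_itv/=; have /andP[F0 F1] := df_itv (Y w).
rewrite !lt_neqAle F0 F1 !andbT; apply/andP; split; apply/eqP => E; apply: nN'; right.
  by left.
by right.
Qed.

End level_sets.

(** * Projections have no atoms *)

Section atomless.
Context d (T : measurableType d) (R : realType) (P : probability T R) (n : nat)
  (X : T -> 'cV[R]_n).
Hypothesis mX : random_vector X.

Lemma measurable_orthant (x : 'cV[R]_n) : measurable [set w | forall i, X w i 0 <= x i 0].
Proof.
rewrite (_ : [set w | _] =
  ~` (\bigcup_(i : 'I_n) (fun w => dotc (delta_mx i 0) (X w)) @^-1` `]x i 0, +oo[)).
  apply: measurableC; apply: countable_bigcupT_measurable => // i.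
  by have := measurable_dotcT (delta_mx i 0) mX measurableT (measurable_itv `]x i 0, +oo[);
    rewrite setTI.
apply/seteqP; split => w /=.
  by move=> h [i _]; rewrite /= in_itv/= dotc_delta andbT ltNge h.
move=> h i; rewrite leNgt; apply/negP => Xi; apply: h; exists i => //.
by rewrite /= in_itv/= dotc_delta andbT.
Qed.

(* An atom of X_i at c is a jump of the joint distribution function at the
   points with i-th coordinate c and other coordinates large. *)
Lemma coord_atomless : continuous (joint_df P X) ->
  forall i c, P ((fun w => X w i 0) @^-1` [set c]) = 0%E.
Proof.
move=> cX i c.
have mc : measurable ((fun w => X w i 0) @^-1` [set c]).
  have := measurable_dotcT (delta_mx i 0) mX measurableT (measurable_set1 c).
  by rewrite setTI; congr measurable; apply/seteqP; split => w /=; rewrite dotc_delta.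
(* Only coordinate [i] is bounded by [c], the others by m, so the sets [A m] exhaust the atom as m
   grows. *)
pose x (m : nat) : 'cV[R]_n := \col_j (if j == i then c else m%:R).
pose Q (y : 'cV[R]_n) := [set w | forall j, X w j 0 <= y j 0].
pose A m := (fun w => X w i 0) @^-1` [set c] `&` Q (x m).
have mQ y : measurable (Q y) by exact: measurable_orthant.
have mA m : measurable (A m) by exact: measurableI.
have fE D : measurable D -> P D = (fine (P D))%:E.
  by move=> mD; rewrite fineK// fin_num_measure.
have A0 m : P.-negligible (A m).
  apply/negligibleP; first exact: mA.
  apply/eqP; rewrite -measure_le0; apply: le_trans (_ : (fine (P (A m)))%:E <= _)%E.
    by rewrite -fE.
  rewrite lee_fin; apply/ler_addgt0Pr => e e0; rewrite add0r.
  have /cvgrPdist_lt/(_ e e0)/nbhs_ballP[r /= r0 hr] := cX (x m).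
  (* [A m] and [Q y] are disjoint subsets of [Q (x m)], so P(A m) is at most the variation of the
     joint distribution function from [y] to [x m]; the shift r / 2 keeps [y] in the ball. *)
  pose y : 'cV[R]_n := \col_j (if j == i then c - r / 2 else m%:R).
  have xy : ball (x m) r y.
    split=> // j k; rewrite !mxE /ball/=; case: ifP => _; last by rewrite subrr normr0.
    by rewrite opprB addrC subrK ger0_norm; lra.
  have := hr _ xy; rewrite /joint_df -/(Q _) -/(Q _) => /ltW; apply: le_trans.
  apply: le_trans (ler_norm _).
  rewrite lerBrDr -lee_fin EFinD -!fE// -measureU//; last first.
    apply/seteqP; split => w //= [[Xc _] /(_ i)]; rewrite mxE eqxx Xc; lra.
  apply: le_measure; rewrite ?inE//; first exact: measurableU.
  move=> w [[_ //]|Qy] j; have := Qy j; rewrite !mxE; case: ifP => _ //; lra.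
apply/negligibleP => //; apply: negligibleS (negligible_bigcup A0).
move=> w /= Xc.
pose s := \sum_j `|X w j 0|.
have s0 : 0 <= s by exact: sumr_ge0.
have [m ms] : exists m : nat, s <= m%:R.
  exists (Num.bound s); have := archi_boundP s0; exact: ltW.
exists m => //; split => //= j; rewrite mxE; case: eqP => [->|_]; first by rewrite Xc.
apply: le_trans (ler_norm _) (le_trans _ ms); rewrite /s (bigD1 j)//= lerDl.
exact: sumr_ge0.
Qed.

End atomless.

(** By [projection_law], the centred projection along [u] has the law of the one along a multiple of
    a basis vector, so an atom would give an atom of a coordinate. *)
Lemma projection_atomless d (T : measurableType d) (R : realType) (P : probability T R)
    n (X : T -> 'cV[R]_n) mu Sigma psi (u : 'cV[R]_n) c :
  elliptical P X mu Sigma psi -> posdef_mx Sigma -> continuous (joint_df P X) ->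
  u != 0 -> P ((fun w => dotc u (X w)) @^-1` [set c]) = 0%E.
Proof.
move=> hX hS cX u0; have mX : random_vector X by case: hX.
have [i ui] : exists i, u i 0 != 0.
  apply: contrapT => h; move/eqP: u0; apply; apply/colP => i; rewrite mxE.
  by apply/eqP; apply: contrapT => /negP ui; apply: h; exists i.
pose q := qform Sigma; pose e : 'cV[R]_n := delta_mx i 0.
have e0 : e != 0.
  by apply/eqP => /matrixP/(_ i 0); rewrite !mxE !eqxx => /eqP; rewrite oner_eq0.
have qe : 0 < q e e by exact: qform_gt0.
have qu : 0 < q u u by exact: qform_gt0.
pose s := Num.sqrt (q u u / q e e).
have s0 : 0 < s by rewrite sqrtr_gt0 divr_gt0.
have qs : q u u = q (s *: e) (s *: e).
  rewrite /q qformZl qformC ?qformZl; last by case: hS.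
  by rewrite mulrA -expr2 sqr_sqrtr ?divfK ?gt_eqF// ltW// divr_gt0.
pose c' := c - dotc u mu.
have mind : measurable_fun [set: R] (\1_[set c'] : R -> R) by exact: measurable_indic.
have := projection_law hX mind qs.
have ind v D : D = (fun w => dotc v (X w - mu)) @^-1` [set c'] -> measurable D ->
    (\int[P]_w (\1_[set c'] (dotc v (X w - mu)))%:E)%E = P D.
  move=> -> mD; have := integral_indic P measurableT mD; rewrite setIT => <-.
  exact: eq_integral.
have mset v : measurable ((fun w => dotc v (X w - mu)) @^-1` [set c']).
  by have := measurable_Z hX v measurableT (measurable_set1 c'); rewrite setTI.
rewrite (ind u ((fun w => dotc u (X w)) @^-1` [set c])); last first.
- rewrite (_ : _ @^-1` _ = (fun w => dotc u (X w - mu)) @^-1` [set c']); first exact: mset.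
  by apply/seteqP; split => w /=; rewrite dotcBr /c' => h; lra.
- by apply/seteqP; split => w /=; rewrite dotcBr /c' => h; lra.
move=> ->.
have E : (fun w => dotc (s *: e) (X w - mu)) @^-1` [set c'] =
    (fun w => X w i 0) @^-1` [set mu i 0 + c' / s].
  apply/seteqP; split => w /=; rewrite dotcZ /e dotc_delta !mxE => h.
    by rewrite -h mulrAC divff ?gt_eqF// mul1r; ring.
  by rewrite h addrC addKr mulrC divfK// gt_eqF.
rewrite (ind (s *: e) ((fun w => X w i 0) @^-1` [set mu i 0 + c' / s])) ?E//.
- exact: coord_atomless.
- by rewrite -E.
Qed.

(** * Conditional moments *)

Section conditional_moments.
Context d (T : measurableType d) (R : realType) (P : probability T R) (B : set T).
Hypothesis mB : measurable B.
Implicit Types f g : T -> R.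

Notation integrable f := (P.-integrable [set: T] (EFin \o f)).

Let integrableB f : integrable f -> P.-integrable B (EFin \o f).
Proof. by apply: integrableS. Qed.

Lemma eq_cond_exp f g : f =1 g -> cond_exp P B f = cond_exp P B g.
Proof. by move=> fg; congr cond_exp; exact/funext. Qed.

Lemma eq_cond_cov f f' g g' : f =1 f' -> g =1 g' ->
  cond_cov P B f g = cond_cov P B f' g'.
Proof. by move=> /funext-> /funext->. Qed.

Lemma cond_expD f g : integrable f -> integrable g ->
  cond_exp P B (fun w => f w + g w) = cond_exp P B f + cond_exp P B g.
Proof.
by move=> /integrableB fi /integrableB gi; rewrite /cond_exp RintegralD// mulrDl.
Qed.

Lemma cond_expZ c f : integrable f ->
  cond_exp P B (fun w => c * f w) = c * cond_exp P B f.
Proof. by move=> /integrableB fi; rewrite /cond_exp RintegralZl// mulrA. Qed.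

(** A null set changes neither the integral over the event nor its probability. *)
Lemma cond_exp_null_event (D N : set T) f : measurable D -> measurable N ->
  P N = 0%E -> (forall w, ~ N w -> D w <-> B w) -> integrable f ->
  cond_exp P D f = cond_exp P B f.
Proof.
move=> mD mN N0 DB fi.
have E g : integrable g -> \int[P]_(w in D) g w = \int[P]_(w in B) g w.
  move=> gi; rewrite /Rintegral.
  rewrite (negligible_integral mN mD)//; last exact: integrableS gi.
  rewrite [in RHS](negligible_integral mN mB)//; last exact: integrableS gi.
  congr (fine (integral _ _ _)).
  by apply/seteqP; split => w [Hw nN]; split => //; apply/(DB w nN).
(* The constant function 1 yields the equality of the two denominators. *)
have := E (cst 1) (sqint_integrable (sqint_cst P 1)).
by rewrite !Rintegral_cst// !mul1r /cond_exp E// => ->.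
Qed.

Hypothesis PB : (0 < P B)%E.

Lemma cond_exp_cst c : cond_exp P B (cst c) = c.
Proof.
rewrite /cond_exp Rintegral_cst// mulfK// gt_eqF// fine_gt0// PB/=.
exact: le_lt_trans (probability_le1 P mB) (ltry 1).
Qed.

Lemma cond_covE f g : sqint P f -> sqint P g ->
  cond_cov P B f g = cond_exp P B (fun w => f w * g w) - cond_exp P B f * cond_exp P B g.
Proof.
move=> sf sg; rewrite /cond_cov.
set a := cond_exp P B f; set b := cond_exp P B g.
rewrite (eq_cond_exp (g := fun w => (f w * g w + (- b) * f w) +
    ((- a) * g w + cst (a * b) w))); last by move=> w /=; ring.
have If := sqint_integrable sf; have Ig := sqint_integrable sg.
have Ifb := sqint_integrable (sqintZ (- b) sf).
have Iga := sqint_integrable (sqintZ (- a) sg).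
have Ic := sqint_integrable (sqint_cst P (a * b)).
rewrite cond_expD; last 2 first.
- exact: (integrableD measurableT (sqintM sf sg) Ifb).
- exact: (integrableD measurableT Iga Ic).
rewrite cond_expD//; last exact: sqintM.
rewrite cond_expD// (cond_expZ _ If) (cond_expZ _ Ig).
rewrite (cond_exp_cst _ : cond_exp P B (fun w => cst (a * b) w) = _) -/a -/b; ring.
Qed.

End conditional_moments.

(** By [elliptical_eq_law] all admissible vectors have the same law, so the set inside [xget] is a
    singleton and any [V] computes its element. Measurability makes the conditioning event the
    preimage of a Borel set of R^2, to which equality in law applies. *)
Lemma Kinv_cond_var (R : realType) d (T : measurableType d) (P : probability T R)
    (V : T -> 'cV[R]_2) (psi : R -> R[i]) (A : set R) :
  elliptical P V 0 1%:M psi ->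
  measurable [set r | A (df P (fun w => V w 0 0) r)] ->
  Kinv psi A =
  cond_var P [set w | A (df P (fun w => V w 0 0) (V w 0 0))] (fun w => V w 1 0).
Proof.
move=> eV mS; rewrite /Kinv; apply: xget_unique.
  by exists d, T, P, V.
move=> _ [d' [T' [P' [V' [eV' ->]]]]].
have mV : random_vector V by case: eV.
have mV' : random_vector V' by case: eV'.
have VV' : eq_law P' V' P V by exact: elliptical_eq_law eV' eV.
have mcoord (i : 'I_2) (D : set R) : measurable D ->
    measurable [set x : borel_cV R 2 | D (x i 0)].
  by move=> mD; have := @measurable_coord R 2 i measurableT D mD; rewrite setTI.
have dfE : df P' (fun w => V' w 0 0) = df P (fun w => V w 0 0).
  apply/funext => r; congr fine.
  exact: (VV' [set x | (x 0 0 : R) \in `]-oo, r]] (mcoord 0 _ (measurable_itv _))).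
rewrite dfE.
set S := [set r | _] in mS.
pose D : set (borel_cV R 2) := [set x | S (x 0 0)].
have mD : measurable D by exact: mcoord.
have ceE (f : borel_cV R 2 -> R) : measurable_fun [set: borel_cV R 2] f ->
    cond_exp P' (V' @^-1` D) (fun w => f (V' w)) = cond_exp P (V @^-1` D) (fun w => f (V w)).
  move=> mf; rewrite /cond_exp (eq_law_Rintegral mV' mV VV' mD mf).
  by congr (_ / fine _); exact: VV'.
rewrite /cond_var /cond_cov.
rewrite -[[set w | _] in LHS]/(V' @^-1` D) -[[set w | _] in RHS]/(V @^-1` D).
have mc : measurable_fun [set: borel_cV R 2] (fun x : borel_cV R 2 => x 1 0 : R).
  exact: measurable_coord.
rewrite (ceE _ mc).
apply: (ceE (fun x => (x 1 0 - _) * (x 1 0 - _))).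
by apply: measurable_funM; apply: measurable_funB.
Qed.

(** * Conditional covariance of projections *)

Section orthogonal_directions.
Context d (T : measurableType d) (R : realType) (P : probability T R) (n : nat)
  (X : T -> 'cV[R]_n) (mu : 'cV[R]_n) (Sigma : 'M[R]_n) (psi : R -> R[i]).
Hypothesis hX : elliptical P X mu Sigma psi.
Hypothesis hSigma : posdef_mx Sigma.
Hypothesis hcont : continuous (joint_df P X).
Hypothesis hrepr : stochastic_repr P X mu Sigma.

Notation Z u := (fun w => dotc u (X w - mu)).
Notation q := (qform Sigma).

Let mX : random_vector X. Proof. by case: hX. Qed.

Let SigmaT : Sigma^T = Sigma. Proof. by case: hSigma. Qed.

(** The matrix M with rows u^T and v^T sends X - mu to the pair, and M Sigma M^T is the Gram matrix
    of u and v for [q]. *)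
Lemma spherical_pair u v : q u u = 1 -> q v v = 1 -> q u v = 0 ->
  exists V : T -> 'cV[R]_2, [/\ elliptical P V 0 1%:M psi,
    (fun w => V w 0 0) = Z u & (fun w => V w 1 0) = Z v].
Proof.
move=> quu qvv quv.
pose p (i : 'I_2) := if i == 0 then u else v.
pose M : 'M[R]_(2, n) := \matrix_(i, j) p i j 0.
have ME i : M^T *m delta_mx i 0 = p i.
  by rewrite -colE; apply/colP => j; rewrite !mxE.
have VE i w : (M *m X w + - (M *m mu)) i 0 = dotc (p i) (X w - mu).
  by rewrite -dotc_delta -mulmxBr dotc_mulmx ME.
exists (fun w => M *m X w + - (M *m mu)); split.
- have -> : 1%:M = M *m Sigma *m M^T.
    apply/matrixP => i j; rewrite -[RHS]qform_delta /qform -mulmxA -mulmxA dotc_mulmx.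
    rewrite !ME -/(q _ _) mxE /p.
    by case: i j => [[|[|//]] ?] [[|[|//]] ?] //=; rewrite ?quu ?qvv ?quv ?(qformC v u SigmaT) ?quv.
  by have := elliptical_affine M (- (M *m mu)) hX; rewrite subrr.
- by apply/funext => w; rewrite VE.
- by apply/funext => w; rewrite VE.
Qed.

Variables (al : 'cV[R]_n) (B1 : set R).
Hypothesis al0 : al != 0.
Hypothesis mB1 : measurable B1.
Notation Y := (fun w => dotc al (X w)).
Notation B := (Y @^-1` B1).
Hypothesis PB : (0 < P B)%E.
Notation k := (Kinv psi (df P Y @` B1 `&` `]0, 1[)).
Notation EB := (cond_exp P B).

Let mB : measurable B.
Proof. by have := measurable_dotcT al mX measurableT mB1; rewrite setTI. Qed.

Let s := Num.sqrt (q al al).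

Let s_gt0 : 0 < s. Proof. by rewrite sqrtr_gt0 qform_gt0. Qed.

Let s2 : s ^+ 2 = q al al. Proof. by rewrite sqr_sqrtr// qform_ge0. Qed.

Let sqZ u : sqint P (Z u).
Proof. exact: (sqint_projection hX hSigma hrepr). Qed.

Let qZZ c u : q (c *: u) (c *: u) = c ^+ 2 * q u u.
Proof. by rewrite qformZl qformC// qformZl; ring. Qed.

Let u := s^-1 *: al.

Let quu : q u u = 1.
Proof. by rewrite /u qZZ exprVn s2 mulVf// gt_eqF// qform_gt0. Qed.

Let YE w : dotc al (X w) = s * Z u w + dotc al mu.
Proof. by rewrite /u dotcZ mulVKf ?gt_eqF// dotcBr subrK. Qed.

(** The pairs built on (u, v) and (u, -v) have the same spherical law, and B constrains the first
    coordinate only, Y being an affine function of it. *)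
Let reflection v (f : R -> R -> R) : q v v = 1 -> q u v = 0 ->
  measurable_fun [set: borel_cV R 2] (fun x : borel_cV R 2 => f (x 0 0) (x 1 0)) ->
  EB (fun w => f (Z u w) (Z v w)) = EB (fun w => f (Z u w) (- Z v w)).
Proof.
move=> qvv quv mf.
have quNv : q u (- v) = 0 by rewrite /qform mulmxN dotcC dotcN dotcC -/(q _ _) quv oppr0.
have qNvv : q (- v) (- v) = 1 by rewrite -scaleN1r qZZ qvv; ring.
have [V [eV V0 V1]] := spherical_pair quu qvv quv.
have [W [eW W0 W1]] := spherical_pair quu qNvv quNv.
have mV : random_vector V by case: eV.
have mW : random_vector W by case: eW.
pose D : set (borel_cV R 2) := [set x | B1 (s * x 0 0 + dotc al mu)].
have mD : measurable D.
  have mg : measurable_fun [set: borel_cV R 2]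
      (fun x : borel_cV R 2 => s * x 0 0 + dotc al mu).
    by apply: measurable_funD => //; apply: measurable_funM => //; exact: measurable_coord.
  by have := mg measurableT _ mB1; rewrite setTI.
have VB : V @^-1` D = B.
  by apply/seteqP; split => w; rewrite /D /= YE -[V w 0 0]/((fun w => V w 0 0) w) V0.
have WB : W @^-1` D = B.
  by apply/seteqP; split => w; rewrite /D /= YE -[W w 0 0]/((fun w => W w 0 0) w) W0.
have := eq_law_Rintegral mV mW (elliptical_eq_law eV eW) mD mf.
rewrite VB WB => h; rewrite /cond_exp; congr (_ / _).
transitivity (\int[P]_(w in B) f (V w 0 0) (V w 1 0)).
  apply: eq_Rintegral => w _.
  by rewrite -[V w 0 0]/((fun w => V w 0 0) w) V0 -[V w 1 0]/((fun w => V w 1 0) w) V1.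
rewrite h; apply: eq_Rintegral => w _.
by rewrite -[W w 0 0]/((fun w => W w 0 0) w) W0 -[W w 1 0]/((fun w => W w 1 0) w) W1 dotcN.
Qed.

(** Reflection applied to y and to x y gives two quantities equal to their opposites. For the third,
    [df_saturation] identifies the conditioning event of [Kinv] with B up to a null set, and the
    conditional variance is the second moment because the conditional mean is 0. *)
Let unit_moments v : q v v = 1 -> q u v = 0 ->
  [/\ EB (Z v) = 0, EB (fun w => Z u w * Z v w) = 0 &
      EB (fun w => Z v w * Z v w) = k].
Proof.
move=> qvv quv.
have m0 := @measurable_coord R 2 0; have m1 := @measurable_coord R 2 1.
have E1 : EB (Z v) = 0.
  have := reflection (f := fun _ y => y) qvv quv m1.
  rewrite [X in _ = X](eq_cond_exp P B (g := fun w => -1 * Z v w));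
    last by move=> w; rewrite mulN1r.
  rewrite cond_expZ//; [by move=> h; lra|exact: sqint_integrable].
split => //.
  have := reflection (f := fun x y => x * y) qvv quv (measurable_funM m0 m1).
  rewrite [X in _ = X](eq_cond_exp P B (g := fun w => -1 * (Z u w * Z v w)));
    last by move=> w; ring.
  rewrite cond_expZ//; [by move=> h; lra|exact: sqintM].
have [V [eV V0 V1]] := spherical_pair quu qvv quv.
have mY : measurable_fun [set: T] Y by exact: measurable_dotcT.
have atom c := projection_atomless c hX hSigma hcont al0.
have [mS [N [mN N0 SN]]] := df_saturation mY atom mB1.
(* Y = s V_1 + al . mu with s > 0, so F_1(V_1) = F_Y(Y). *)
have dfV r : df P (fun w => V w 0 0) r = df P Y (s * r + dotc al mu).
  congr (fine (P _)); apply/seteqP; rewrite V0.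
  by split => w /=; rewrite !in_itv/= YE lerD2r ler_pM2l.
have mg : measurable_fun [set: R] (fun r : R => s * r + dotc al mu).
  by apply: measurable_funD => //; exact: measurable_funM.
rewrite (Kinv_cond_var eV); last first.
  have := mg measurableT _ mS; rewrite setTI; congr measurable.
  by apply/seteqP; split => r /=; rewrite dfV.
set D := [set w | _].
have DE : D = Y @^-1` [set r | (df P Y @` B1 `&` `]0, 1[) (df P Y r)].
  apply/seteqP; rewrite /D; split => w /=; rewrite dfV;
    by rewrite -[V w 0 0]/((fun w => V w 0 0) w) V0 -YE.
have mD : measurable D by rewrite DE; have := mY measurableT _ mS; rewrite setTI.
have DB w : ~ N w -> D w <-> B w by move=> /SN; rewrite DE.
have iv := sqint_integrable (sqZ v).
rewrite V1 /cond_var /cond_cov (cond_exp_null_event mB mD mN N0 DB iv) E1.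
rewrite (cond_exp_null_event mB mD mN N0 DB).
  by apply: eq_cond_exp => w; rewrite subr0.
have := sqintM (sqZ v) (sqZ v).
by congr (_.-integrable _ _); apply/funext => w /=; rewrite subr0.
Qed.

(** Rescaling [e] to unit length reduces to [unit_moments]; e = 0 cannot be normalized and is
    treated apart. *)
Let orthogonal_moments e : q al e = 0 ->
  [/\ EB (Z e) = 0, EB (fun w => Z al w * Z e w) = 0 &
      EB (fun w => Z e w * Z e w) = k * q e e].
Proof.
move=> qe; have [->|e0] := eqVneq e 0.
  have Z0 w : Z 0 w = 0 by rewrite dotcE big1// => i _; rewrite mxE mul0r.
  have E0 : EB (fun=> 0) = 0 by rewrite /cond_exp Rintegral_cst// mul0r mul0r.
  rewrite /qform mulmx0 -[X in k * X](dotcC 0) (_ : dotc 0 0 = 0); last first.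
    by rewrite dotcE big1// => i _; rewrite mxE mul0r.
  by split; rewrite ?mulr0 -[RHS]E0; apply: eq_cond_exp => w; rewrite Z0 ?mulr0.
pose t := Num.sqrt (q e e); pose v := t^-1 *: e.
have t_gt0 : 0 < t by rewrite sqrtr_gt0 qform_gt0.
have t2 : t ^+ 2 = q e e by rewrite sqr_sqrtr// qform_ge0.
have qvv : q v v = 1 by rewrite /v qZZ exprVn t2 mulVf// gt_eqF// qform_gt0.
have quv : q u v = 0 by rewrite /u /v qformZl qformC// qformZl qformC// qe !mulr0.
have [h1 h2 h3] := unit_moments qvv quv.
have eE w : Z e w = t * Z v w by rewrite /v dotcZ mulVKf// gt_eqF.
have aE w : Z al w = s * Z u w by rewrite /u dotcZ mulVKf// gt_eqF.
have iv := sqint_integrable (sqZ v).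
split.
- rewrite (eq_cond_exp P B (g := fun w => t * Z v w)) // cond_expZ// h1 mulr0//.
- rewrite (eq_cond_exp P B (g := fun w => s * t * (Z u w * Z v w))).
    by rewrite cond_expZ ?h2 ?mulr0//; exact: sqintM.
  by move=> w; rewrite eE aE; ring.
- rewrite (eq_cond_exp P B (g := fun w => t ^+ 2 * (Z v w * Z v w))).
    by rewrite cond_expZ ?h3 ?t2 1?mulrC//; exact: sqintM.
  by move=> w; rewrite eE; ring.
Qed.

(** Polarization along e, f and e + f, all orthogonal to [al]. *)
Lemma orthogonal_cond_moments e f : q al e = 0 -> q al f = 0 ->
  [/\ EB (Z e) = 0, EB (fun w => Z al w * Z e w) = 0 &
      EB (fun w => Z e w * Z f w) = k * q e f].
Proof.
move=> qe qf; have [e1 e2 e3] := orthogonal_moments qe; split => //.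
have [_ _ f3] := orthogonal_moments qf.
have qef : q al (e + f) = 0 by rewrite qformC// qformDl !(qformC _ al)// qe qf addr0.
have [_ _] := orthogonal_moments qef.
rewrite (eq_cond_exp P B (g := fun w =>
  (Z e w * Z e w + Z f w * Z f w) + 2 * (Z e w * Z f w))); last first.
  by move=> w; rewrite dotcD; ring.
have Ie := sqintM (sqZ e) (sqZ e); have If := sqintM (sqZ f) (sqZ f).
have Ief := sqintM (sqZ e) (sqZ f).
rewrite cond_expD//; last 2 first.
- exact: (integrableD measurableT Ie If).
- exact: (integrableZl measurableT 2 Ief).
rewrite cond_expD// (cond_expZ mB _ Ief)// e3 f3.
rewrite qformDl ![q _ (e + f)]qformC// !qformDl (qformC f e SigmaT).
move=> h; lra.
Qed.

(** Split x = bx al + e and y = b' al + f with e and f orthogonal to [al]. The mixed terms vanish,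
    the part along [al] contributes bx b' times the conditional variance of Y, and the rest is k
    q(e, f). *)
Lemma cond_cov_projection x y :
  cond_cov P B (fun w => dotc x (X w)) (fun w => dotc y (X w)) =
  k * q x y + (cond_var P B Y - k * q al al) * (q al x / q al al) * (q al y / q al al).
Proof.
set qa := q al al; have qa0 : qa != 0 by rewrite gt_eqF// qform_gt0.
pose bx := q al x / qa; pose b' := q al y / qa.
pose e := x - bx *: al; pose f := y - b' *: al.
have orth z : q al (z - (q al z / qa) *: al) = 0.
  by rewrite qformC// -scaleNr qformDl qformZl (qformC z al)// mulNr divfK ?subrr.
have qe : q al e = 0 := orth x.
have qf : q al f = 0 := orth y.
have [e1 e2 ef] := orthogonal_cond_moments qe qf.
have [f1 f2 _] := orthogonal_cond_moments qf qe.
have xE w : dotc x (X w) = (bx * Z al w + Z e w) + cst (dotc x mu) w.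
  by rewrite /e dotcD -scaleNr dotcZ dotcBr dotcBr /=; ring.
have yE w : dotc y (X w) = (b' * Z al w + Z f w) + cst (dotc y mu) w.
  by rewrite /f dotcD -scaleNr dotcZ dotcBr dotcBr /=; ring.
have aE w : dotc al (X w) = Z al w + cst (dotc al mu) w.
  by rewrite dotcBr /= subrK.
have sc c := sqint_cst P c.
(* Additive constants drop out, so projections may be replaced by their centred versions. *)
have covD g h c c' : sqint P g -> sqint P h ->
    cond_cov P B (fun w => g w + cst c w) (fun w => h w + cst c' w) =
    EB (fun w => g w * h w) - EB g * EB h.
  move=> sg sh; rewrite cond_covE//; [|exact: sqintD|exact: sqintD].
  have Ig := sqint_integrable sg; have Ih := sqint_integrable sh.
  have Ic c0 := sqint_integrable (sc c0).
  have Igh := sqintM sg sh.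
  have Ich := sqint_integrable (sqintZ c sh).
  have Icg := sqint_integrable (sqintZ c' sg).
  rewrite (eq_cond_exp P B (g := fun w =>
    (g w * h w + c * h w) + (c' * g w + cst (c * c') w))); last first.
    by move=> w /=; ring.
  rewrite (cond_expD mB Ig (Ic c)) (cond_expD mB Ih (Ic c')).
  rewrite (cond_expD mB (f := fun w => g w * h w + c * h w)); last 2 first.
  - exact: (integrableD measurableT Igh Ich).
  - exact: (integrableD measurableT Icg (Ic _)).
  rewrite (cond_expD mB Igh Ich) (cond_expD mB Icg (Ic _)).
  rewrite (cond_expZ mB _ Ig) (cond_expZ mB _ Ih).
  have Ec c0 : EB (fun w => cst c0 w) = c0 by exact: cond_exp_cst.
  by rewrite (Ec c) (Ec c') (Ec (c * c')); ring.
have IZ z := sqint_integrable (sqZ z).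
have IZZ z z' := sqintM (sqZ z) (sqZ z').
have -> : cond_var P B Y = EB (fun w => Z al w * Z al w) - EB (Z al) * EB (Z al).
  transitivity (cond_cov P B (fun w => Z al w + cst (dotc al mu) w)
      (fun w => Z al w + cst (dotc al mu) w)); last by rewrite covD.
  exact: eq_cond_cov.
transitivity (cond_cov P B (fun w => (bx * Z al w + Z e w) + cst (dotc x mu) w)
    (fun w => (b' * Z al w + Z f w) + cst (dotc y mu) w)).
  exact: eq_cond_cov.
rewrite covD; [|by apply: sqintD => //; exact: sqintZ..].
have EL b z : EB (fun w => b * Z al w + Z z w) = b * EB (Z al) + EB (Z z).
  rewrite cond_expD ?cond_expZ//.
  exact: sqint_integrable (sqintZ b (sqZ al)).
rewrite (EL bx e) (EL b' f) e1 f1.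
rewrite (eq_cond_exp P B (g := fun w =>
   (bx * b' * (Z al w * Z al w) + bx * (Z al w * Z f w)) +
   (b' * (Z al w * Z e w) + Z e w * Z f w))); last by move=> w; ring.
have I1 := integrableZl measurableT (bx * b') (IZZ al al).
have I2 := integrableZl measurableT bx (IZZ al f).
have I3 := integrableZl measurableT b' (IZZ al e).
rewrite cond_expD//; last 2 first.
- exact: (integrableD measurableT I1 I2).
- exact: (integrableD measurableT I3 (IZZ e f)).
rewrite !cond_expD// (cond_expZ mB _ (IZZ al al)) (cond_expZ mB _ (IZZ al f)).
rewrite (cond_expZ mB _ (IZZ al e)).
rewrite e2 f2 ef.
(* Orthogonality of [f] to [al] leaves q(x, f), and q(al, x) = bx qa. *)
have -> : q e f = q x y - bx * b' * qa.
  rewrite {1}/e qformDl -scaleNr qformZl qf mulr0 addr0 qformC//.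
  rewrite {1}/f qformDl -scaleNr qformZl (qformC y x)// /bx.
  by rewrite mulrAC divfK// mulNr [q al x * _]mulrC.
rewrite -/bx -/b'; ring.
Qed.

End orthogonal_directions.

(** * The conditional covariance matrix *)

Theorem theorem4p1 (R : realType) (d : measure_display) (T : measurableType d)
    (P : probability T R) (n : nat) (X : T -> 'cV[R]_n)
    (mu : 'cV[R]_n) (Sigma : 'M[R]_n) (psi : R -> R[i])
    (hX : elliptical P X mu Sigma psi)
    (hSigma : posdef_mx Sigma)
    (hcont : continuous (joint_df P X))
    (hrepr : stochastic_repr P X mu Sigma)
    (hvar : forall i j : 'I_n,
       covariance P (fun w => X w i 0) (fun w => X w j 0) \is a fin_num)
    (hpsi : n = 1%N -> bivariate_exists psi)
    (a : 'rV[R]_n) (ha : a != 0)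
    (B1 : set R) (hB1 : measurable B1)
    (hPB : (0 < P [set w | B1 ((a *m X w) 0 0)%R])%E) :
  let Y := fun w => (a *m X w) 0 0 in
  let B := Y @^-1` B1 in
  let k := Kinv psi (df P Y @` B1 `&` `]0, 1[) in
  let VarY := fine (variance P Y) in
  let beta := VarY^-1 *: cov_vec P X Y in
  beta = ((a *m Sigma *m a^T) 0 0)^-1 *: (Sigma *m a^T) /\
  cond_cov_mx P B X =
    k *: cov_mx P X + (cond_var P B Y - k * VarY) *: (beta *m beta^T).
Proof.
move=> Y B k VarY beta.
set al := a^T.
have YE : Y = (fun w => dotc al (X w)).
  by apply/funext => w; rewrite /Y /dotc trmxK.
have al0 : al != 0.
  by apply: contra ha => /eqP e; rewrite -(trmxK a) -/al e trmx0.
have covE := projection_covariance hX hSigma hrepr.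
(* Coordinates are projections along the basis vectors, so each matrix entry is an instance of a
   statement on projections. *)
have coordE i : (fun w => X w i 0) = (fun w => dotc (delta_mx i 0) (X w)).
  by apply/funext => w; rewrite dotc_delta.
have VarYE : VarY = qform Sigma al al by rewrite /VarY /variance YE covE.
have covYE i : cov_vec P X Y i 0 = qform Sigma (delta_mx i 0) al.
  by rewrite mxE coordE YE covE.
have SaE i : (Sigma *m al) i 0 = qform Sigma (delta_mx i 0) al.
  by rewrite /qform dotc_delta.
have betaE : beta = VarY^-1 *: (Sigma *m al).
  by rewrite /beta; congr (_ *: _); apply/colP => i; rewrite covYE SaE.
split.
  by rewrite betaE VarYE /qform /dotc trmxK mulmxA.
have PB : (0 < P ((fun w => dotc al (X w)) @^-1` B1))%E by rewrite -YE.
apply/matrixP => i j.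
have bE l : beta l 0 = qform Sigma al (delta_mx l 0) / qform Sigma al al.
  by rewrite betaE mxE SaE VarYE mulrC qformC//; case: hSigma.
rewrite [LHS]mxE !coordE /B /k YE.
rewrite (cond_cov_projection hX hSigma hcont hrepr al0 hB1 PB).
have bbE : (beta *m beta^T) i j = beta i 0 * beta j 0.
  by rewrite mxE big_ord1 [beta^T _ _]mxE.
rewrite [RHS]mxE [X in _ = X + _]mxE [X in _ = _ + X]mxE bbE [cov_mx _ _ _ _]mxE.
by rewrite !coordE covE !bE VarYE -mulrA.
Qed.
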